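(* Let $B_{jk}\in\mathbb{R}$ ($j=1,2,3$, $k\in\mathbb{N}^3$) with $\sum_{k\in\mathbb{N}^3}B_{jk}\varphi_k\in C^\infty(\mathbb{R}_+^3)$ for $j=1,2,3$. Suppose $B_{j,(0,0,0)}\leq -2$ for $j=1,2,3$, let $\epsilon>0$, and suppose $$|B_{jk}|\leq \frac{e^{-|k|(1+\epsilon)}}{10^3}\prod_{l\in\{1,2,3\},\ k_l>0}\frac{k_l^{k_l-1}}{k_l!},\qquad k>(0,0,0),\ j=1,2,3.$$ Then the Cauchy problem for the incompressible Euler equations $$\left\{\begin{array}{l} \partial_t u_j+\sum_{i=1}^{3}u_i\,\partial_{x_i}u_j+\partial_{x_j}p=0,\quad j=1,2,3,\\ \partial_{x_1}u_1+\partial_{x_2}u_2+\partial_{x_3}u_3=0,\qquad x\in\mathbb{R}_+^3,\ t\geq0,\\ u_j(x,0)=\sum_{k\in\mathbb{N}^3}B_{jk}\varphi_k(x),\quad j=1,2,3,\end{array}\right.$$ has a series solution $u_j(x,t)=\sum_{k\in\mathbb{N}^3}T_{jk}(t)\varphi_k(x)$ ($j=1,2,3$), $p(x,t)=\sum_{k\in\mathbb{N}^3}T_{4k}(t)\varphi_k(x)$, for some functions $T_{jk}$ on $[0,+\infty)$, such that for all $i,j\in\{1,2,3\}$ the following equalities hold and all the functions in them are continuous on $\mathbb{R}_+^3\times[0,+\infty)$: $$u_j=\sum_{k}T_{jk}(t)\varphi_k,\quad p=\sum_kT_{4k}(t)\varphi_k,\quad \partial_tu_j=\sum_kT'_{jk}(t)\varphi_k,\quad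 \partial_{x_i}u_j=\sum_k -k_iT_{jk}(t)\varphi_k,$$ $$\partial_{x_j}p=\sum_k-k_jT_{4k}(t)\varphi_k,\quad u_i\,\partial_{x_i}u_j=\sum_k\eta_{ijk}(t)\varphi_k,\quad\text{where } \eta_{ijk}=\sum_{k^{[1]}+k^{[2]}=k}-k_i^{[2]}T_{ik^{[1]}}T_{jk^{[2]}}.$$
   Context: $\mathbb{N}=\{0,1,2,\dots\}$; $k=(k_1,k_2,k_3)\in\mathbb{N}^3$, $|k|=k_1+k_2+k_3$; $k>(0,0,0)$ means $k\in\mathbb{N}^3$, $k\neq(0,0,0)$; $\mathbb{R}_+^3=\{(r_1,r_2,r_3)\in\mathbb{R}^3: r_j\geq0,\ j=1,2,3\}$; $\varphi_k(x)=\exp(-k_1x_1-k_2x_2-k_3x_3)$. Sums over $k$ run over $\mathbb{N}^3$; in $\eta_{ijk}$ the sum runs over all pairs $k^{[1]},k^{[2]}\in\mathbb{N}^3$ with $k^{[1]}+k^{[2]}=k$.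
   Formalization: The initial velocity is additionally assumed divergence-free on R_+^3; without this the claim fails at t=0, e.g. B_{j,0}=-2, B_{1,(1,0,0)}=e^{-(1+ε)}/1000, all other B_{jk}=0. *)

(* Defs.v *)
From HB Require Import structures.
From mathcomp Require Import all_boot all_order all_algebra finmap.
From mathcomp Require Import all_classical all_reals all_analysis.
From mathcomp.analysis.showcase Require summability.

Set Implicit Arguments.
Unset Strict Implicit.
Unset Printing Implicit Defensive.

Import Order.TTheory GRing.Theory Num.Theory.
Import numFieldNormedType.Exports.

Local Open Scope classical_set_scope.
Local Open Scope ring_scope.

(* N^3, with the pointwise addition. *)
Notation idx := {ffun 'I_3 -> nat}.

Definition absk (k : idx) : nat := (\sum_(l < 3) k l)%N.

(* Unconditional convergence: the finite partial sums converge along the net of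
   finite sets of indices.  In R this is absolute convergence, so the value does
   not depend on how N^3 is enumerated. *)
Definition has_sum (R : realType) (a : idx -> R) (s : R) : Prop :=
  summability.partial_sum a @ summability.totally --> s.

Section Derivatives.
Context {R : realType} {V : normedModType R}.
Implicit Types (D : set V) (f : V -> R).

(* [derivable] and [derive] with increments that stay in D; on the boundary of
   a closed D these are one-sided derivatives. *)
Definition derivable_in D f (a v : V) : Prop :=
  cvg ((fun h : R => h^-1 *: (f (a + h *: v) - f a))
         @ within [set h | D (a + h *: v)] 0^').

Definition derive_in D f (a v : V) : R :=
  lim ((fun h : R => h^-1 *: (f (a + h *: v) - f a))
         @ within [set h | D (a + h *: v)] 0^').

End Derivatives.

Section Orthant.
Context {R : realType}.

Definition orthant : set 'rV[R]_3 := [set x | forall j, 0 <= x ord0 j].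

Definition halfline : set R := [set t | 0 <= t].

Definition e_ (i : 'I_3) : 'rV[R]_3 := delta_mx ord0 i.

Definition partial_derivable (i : 'I_3) (f : 'rV[R]_3 -> R) (x : 'rV[R]_3) :=
  derivable_in orthant f x (e_ i).

Definition partial (i : 'I_3) (f : 'rV[R]_3 -> R) (x : 'rV[R]_3) : R :=
  derive_in orthant f x (e_ i).

Definition time_derivable (g : R -> R) (t : R) := derivable_in halfline g t 1.

Definition time_derive (g : R -> R) (t : R) : R := derive_in halfline g t 1.

(* C^oo on the closed orthant: the partial derivatives of all orders (one-sided
   on the boundary) exist and are continuous on the orthant. *)
Definition smooth (f : 'rV[R]_3 -> R) : Prop :=
  forall s : seq 'I_3,
    {within orthant, continuous (foldr partial f s)} /\
    forall i x, orthant x -> partial_derivable i (foldr partial f s) x.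

Definition phi (k : idx) (x : 'rV[R]_3) : R :=
  expR (- \sum_(l < 3) (k l)%:R * x ord0 l).

Definition continuous_spacetime (F : 'rV[R]_3 -> R -> R) : Prop :=
  {within orthant `*` halfline, continuous (fun z => F z.1 z.2)}.

(* F = \sum_k a_k(t) phi_k on the closed orthant for t >= 0, where F and every
   term of the series are continuous in (x, t). *)
Definition series_expansion (F : 'rV[R]_3 -> R -> R) (a : idx -> R -> R) :=
  [/\ forall x (t : R), orthant x -> 0 <= t ->
        has_sum (fun k => a k t * phi k x) (F x t),
      continuous_spacetime F
    & forall k, continuous_spacetime (fun x t => a k t * phi k x)].

Definition eta_series (T : 'I_3 -> idx -> R -> R) (i j : 'I_3) (k : idx) (t : R) : R :=
  \sum_(q \in [set q : idx * idx | q.1 + q.2 = k])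
     - (q.2 i)%:R * T i q.1 t * T j q.2 t.

(* Also imposed on the initial velocity: it is the incompressibility equation at
   t = 0, without which the Cauchy problem has no solution. *)
Definition divergence_free (v : 'I_3 -> 'rV[R]_3 -> R) : Prop :=
  forall x, orthant x -> \sum_(i < 3) partial i (v i) x = 0.

Definition euler_solution (u0 : 'I_3 -> 'rV[R]_3 -> R)
    (u : 'I_3 -> 'rV[R]_3 -> R -> R) (p : 'rV[R]_3 -> R -> R) : Prop :=
  [/\ (* the derivatives occurring in the equations exist *)
      forall x (t : R), orthant x -> 0 <= t ->
        [/\ forall j, time_derivable (u j x) t,
            forall i j, partial_derivable i (u j ^~ t) x
          & forall j, partial_derivable j (p ^~ t) x],
      forall j x (t : R), orthant x -> 0 <= t ->
        time_derive (u j x) t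
        + \sum_(i < 3) u i x t * partial i (u j ^~ t) x
        + partial j (p ^~ t) x = 0,
      forall t : R, 0 <= t -> divergence_free (fun i => u i ^~ t)
    & forall j x, orthant x -> u j x 0 = u0 j x].

End Orthant.

(* Main.v *)
(* With b = (B_(1,0), B_(2,0), B_(3,0)) the mean flow, the nonzero modes satisfy
     T_jk' = (k . b) T_jk + sum_(k1 + k2 = k; k1, k2 <> 0) (k . T_k1) P_k(T_k2)_j,
   P_k being the projection orthogonal to k, so T_jk(t) = exp((k . b) t) V_jk(t)
   with V_jk a polynomial in t determined by recursion on |k|.  By induction
     |V_jk(t)| <= exp(- eps |k|) A_k (1 + t)^(|k| - 1),
   where A solves the quadratic recursion A_k = c_k + 6 sum A_k1 A_k2 and c_k is
   10^-3 times a product of weights w_n = exp(- n) n^(n-1) / n! (w_0 = 1): the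
   factor |k| of the nonlinearity is compensated by integrating
   (1 + t)^(|k| - 2), and A is summable because the c_k add up to at most 1/24.
   As k . b <= - 2 |k|, the exponential absorbs (1 + t)^|k|, hence
   |T_jk(t)| <= exp(- eps |k|) for all t >= 0.  Every series in sight is thus
   dominated by a geometric one, uniformly in (x, t). *)

Require Import Defs.
From HB Require Import structures.
From mathcomp Require Import all_boot all_order all_algebra finmap.
From mathcomp Require Import all_classical all_reals all_analysis.
From mathcomp Require Import ring lra zify.
From mathcomp.analysis.showcase Require summability.

Set Implicit Arguments.
Unset Strict Implicit.
Unset Printing Implicit Defensive.

Import Order.TTheory GRing.Theory Num.Theory.
Import numFieldNormedType.Exports.

Local Open Scope classical_set_scope.
Local Open Scope ring_scope.

(** The factor [expR (dot k b * t)] is multiplicative in [k], so it commutes with the convolution: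
    dividing by it removes the linear term and leaves a right-hand side of strictly lower degree.
    The factor [rho ^+ absk k], with [rho = expR (- eps)], is multiplicative too and passes through
    the induction untouched; all decay comes from it, and [A] only has to stay below 1. The 6 is 3,
    a bound for the projection in the sup norm, times 2, from [|k| <= 2 (|k| - 1)] when two nonzero
    modes add up to [k]. The numbers n^(n-1) / n! are the Taylor coefficients of the tree function,
    whose radius of convergence is 1/e. The [w_n] with n > 0 are its terms at this critical point,
    where the series still converges: summability uses up exp(- |k|), and exp(- eps |k|) is left.
    The projected system solves the Euler equations only if each mode is orthogonal to its [k]. Time
    evolution preserves this, but at time 0 it must be extracted from [divergence_free u0], an
    identity between functions; hence a uniqueness theorem for coefficients of exponential
    series. *)

(** * Finite boxes and decompositions of multi-indices *)

Definition box (n : nat) : seq idx :=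
  [seq [ffun l => nat_of_ord (f l)] | f : {ffun 'I_3 -> 'I_n}].

(** Both members of a decomposition of [k] have coordinates at most [absk k], so filtering a finite
    box misses none. *)
Definition pairs (k : idx) : seq (idx * idx) :=
  [seq q <- [seq (a, b) | a <- box (absk k).+1, b <- box (absk k).+1]
   | q.1 + q.2 == k].

Lemma idx_addE (a b : idx) l : (a + b) l = (a l + b l)%N.
Proof. by rewrite ffunE. Qed.

Lemma idx0E l : (0 : idx) l = 0%N.
Proof. by rewrite ffunE. Qed.

Lemma abskD (a b : idx) : absk (a + b) = (absk a + absk b)%N.
Proof. by rewrite /absk -big_split; apply: eq_bigr => l _; rewrite idx_addE. Qed.

Lemma leq_absk (k : idx) l : (k l <= absk k)%N.
Proof. by rewrite /absk (bigD1 l) //= leq_addr. Qed.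

Lemma absk_eq0 (k : idx) : (absk k == 0%N) = (k == 0).
Proof.
apply/eqP/eqP => [k0|->]; last first.
  by rewrite /absk big1// => l _; rewrite idx0E.
by apply/ffunP => l; rewrite idx0E; have := leq_absk k l; rewrite k0 leqn0 => /eqP.
Qed.

Lemma absk0 : absk 0 = 0%N.
Proof. by apply/eqP; rewrite absk_eq0. Qed.

Lemma absk_gt0 (k : idx) : (0 < absk k)%N = (k != 0).
Proof. by rewrite lt0n absk_eq0. Qed.

Lemma mem_box n (k : idx) : (k \in box n) = [forall l, (k l < n)%N].
Proof.
apply/mapP/forallP => [[f _ ->] l|kn]; first by rewrite ffunE.
exists [ffun l => Ordinal (kn l)]; first by rewrite mem_enum.
by apply/ffunP => l; rewrite !ffunE.
Qed.

Lemma box_uniq n : uniq (box n).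
Proof.
rewrite map_inj_uniq ?enum_uniq// => f g /ffunP fg.
by apply/ffunP => l; apply/val_inj; have := fg l; rewrite !ffunE.
Qed.

Lemma notin_box n (k : idx) : k \notin box n -> (n <= absk k)%N.
Proof.
rewrite mem_box negb_forall => /existsP[l]; rewrite -leqNgt => /leq_trans.
by apply; exact: leq_absk.
Qed.

Lemma box_addP n (a b : idx) : a + b \in box n -> a \in box n /\ b \in box n.
Proof.
rewrite !mem_box => /forallP abn.
split; apply/forallP => l; apply: leq_ltn_trans (abn l); rewrite idx_addE.
  exact: leq_addr.
exact: leq_addl.
Qed.

Lemma mem_box_absk (k : idx) : k \in box (absk k).+1.
Proof. by rewrite mem_box; apply/forallP => l; rewrite ltnS leq_absk. Qed.

Lemma mem_boxX n (q : idx * idx) :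
  (q \in [seq (a, b) | a <- box n, b <- box n]) =
  (q.1 \in box n) && (q.2 \in box n).
Proof.
case: q => q1 q2 /=; apply/allpairsP/andP => [[[a b] /= [? ? [-> ->]]]//|[? ?]].
by exists (q1, q2).
Qed.

Lemma boxX_uniq n : uniq [seq (a, b) | a <- box n, b <- box n].
Proof. by rewrite allpairs_uniq ?box_uniq// => -[a b] [a' b'] /= _ _. Qed.

Lemma mem_pairs (k : idx) (q : idx * idx) : (q \in pairs k) = (q.1 + q.2 == k).
Proof.
rewrite mem_filter mem_boxX; case: eqP => //= <-.
by have [-> ->] := box_addP (mem_box_absk (q.1 + q.2)).
Qed.

Lemma pairs_uniq k : uniq (pairs k).
Proof. by rewrite filter_uniq// boxX_uniq. Qed.

Lemma absk_pairs (k : idx) q : q \in pairs k -> (absk q.1 + absk q.2)%N = absk k.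
Proof. by rewrite mem_pairs => /eqP <-; rewrite abskD. Qed.

Lemma fsbig_pairs (R : realType) (F : idx * idx -> R) (k : idx) :
  \sum_(q \in [set q : idx * idx | q.1 + q.2 = k]) F q = \sum_(q <- pairs k) F q.
Proof.
rewrite [RHS]fsbig_seq ?pairs_uniq//.
suff -> : [set q : idx * idx | q.1 + q.2 = k] = [set` pairs k] by [].
by apply/seteqP; split=> q /=; rewrite mem_pairs => /eqP.
Qed.

Lemma sum_subset (R : numDomainType) (I : eqType) (F G : seq I) (a : I -> R) :
  uniq F -> uniq G -> {subset F <= G} -> (forall i, i \in G -> 0 <= a i) ->
  \sum_(i <- F) a i <= \sum_(i <- G) a i.
Proof.
move=> uF uG FG a0.
rewrite (perm_big [seq i <- G | i \in F]) /=; last first.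
  apply: uniq_perm => //; first exact: filter_uniq.
  by move=> i; rewrite mem_filter; case: (boolP (i \in F)) => // /FG.
rewrite big_filter big_mkcond big_seq [leRHS]big_seq; apply: ler_sum => i /a0.
by case: ifP.
Qed.

Lemma sum_box_prod (R : comRingType) n (w : 'I_3 -> nat -> R) :
  \sum_(k <- box n) \prod_l w l (k l) = \prod_l \sum_(i < n) w l i.
Proof.
rewrite big_map big_enum bigA_distr_bigA; apply: eq_bigr => f _.
by apply: eq_bigr => l _; rewrite ffunE.
Qed.

(** A box is closed downwards, so every decomposition of one of its points lies in the square of the
    box. [P] makes room for the restriction to nonzero pairs. *)
Lemma sum_box_pairs (R : zmodType) n (P : pred (idx * idx))
    (F : idx * idx -> R) :
  \sum_(k <- box n) \sum_(q <- pairs k | P q) F q =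
  \sum_(q <- [seq (a, b) | a <- box n, b <- box n]
     | (q.1 + q.2 \in box n) && P q) F q.
Proof.
set X := [seq _ | _ <- _, _ <- _].
transitivity (\sum_(k <- box n) \sum_(q <- X | (q.1 + q.2 == k) && P q) F q).
  rewrite big_seq [RHS]big_seq; apply: eq_bigr => k kn.
  rewrite -big_filter_cond; apply: perm_big.
  apply: uniq_perm; rewrite ?pairs_uniq ?filter_uniq ?boxX_uniq// => q.
  rewrite mem_pairs mem_filter; case: eqP => //= qk.
  by rewrite mem_boxX; move: kn; rewrite -qk => /box_addP[-> ->].
rewrite (exchange_big_dep P) => [|k q _ /andP[]//] /=.
rewrite [RHS]big_mkcondl; apply: eq_bigr => q Pq.
under eq_bigl do rewrite Pq andbT eq_sym.
case: ifPn => qn.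
  by rewrite -big_filter filter_pred1_uniq ?box_uniq // big_seq1.
rewrite big_seq_cond big1// => k /andP[kn /eqP qk].
by rewrite -qk kn in qn.
Qed.

Lemma boxX_sum (R : pzRingType) n (F G : idx -> R) :
  \sum_(q <- [seq (a, b) | a <- box n, b <- box n]) F q.1 * G q.2 =
  (\sum_(k <- box n) F k) * \sum_(k <- box n) G k.
Proof.
rewrite big_allpairs_dep mulr_suml; apply: eq_bigr => a _.
by rewrite mulr_sumr.
Qed.

(* Geometrically dominated sums over multi-indices *)
#[export] Existing Instance summability.totally_filter.

Section GeometricSums.
Context {R : realType}.
Implicit Types (a b : idx -> R) (C q : R).

Definition dominated C q a := forall k, `|a k| <= C * q ^+ absk k.

Definition psum a n := \sum_(k <- box n) a k.

Lemma psumE a (F : {fset idx}) :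
  summability.partial_sum a F = \sum_(k <- F) a k.
Proof. by rewrite big_seq_fsetE. Qed.

Lemma geom_sum_le q n : 0 <= q -> q < 1 -> \sum_(i < n) q ^+ i <= (1 - q)^-1.
Proof.
move=> q0 q1; have q1' : 0 < 1 - q by rewrite subr_gt0.
rewrite -[leRHS]mul1r ler_pdivlMr// mulrC.
have := subrX1 q n; have := exprn_ge0 n q0; set s := \sum_(i < n) _.
by move=> qn h; nra.
Qed.

Lemma expr_absk q (k : idx) : q ^+ absk k = \prod_l q ^+ k l.
Proof. by rewrite /absk expr_sum. Qed.

Lemma sum_geom_idx_le q (F : seq idx) : 0 <= q -> q < 1 -> uniq F ->
  \sum_(k <- F) q ^+ absk k <= (1 - q)^-1 ^+ 3.
Proof.
move=> q0 q1 uF; pose n := (\sum_(k <- F) absk k).+1.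
have Fn : {subset F <= box n}.
  move=> k kF; rewrite mem_box; apply/forallP => l.
  by rewrite ltnS /n (big_rem k kF) /=; have := leq_absk k l; lia.
apply: (le_trans (sum_subset uF (box_uniq n) Fn _)) => [k _|].
  exact: exprn_ge0.
under eq_bigr do rewrite expr_absk.
rewrite (sum_box_prod n (fun=> fun i => q ^+ i)) prodr_const card_ord.
apply: lerXn2r; rewrite ?nnegrE ?invr_ge0 ?subr_ge0 ?(ltW q1)//.
  by apply: sumr_ge0 => i _; exact: exprn_ge0.
exact: geom_sum_le.
Qed.

(** The rate is split as [Num.sqrt q * Num.sqrt q]: one factor gives the smallness in [n], the other
    pays for the summation over all indices. *)
Definition tail C q n : R :=
  C * ((1 - Num.sqrt q)^-1 ^+ 3 * Num.sqrt q ^+ n).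

Lemma sqrt_lt1 q : q < 1 -> Num.sqrt q < 1.
Proof. by move=> q1; rewrite -sqrtr1 ltr_sqrt. Qed.

Lemma tail_cvg C q : q < 1 -> tail C q @ \oo --> (0 : R).
Proof.
move=> /sqrt_lt1 q1; rewrite -[0](mulr0 C); apply: cvgMr.
rewrite -[0](mulr0 ((1 - Num.sqrt q)^-1 ^+ 3)); apply: cvgMr.
by apply: cvg_expr; rewrite ger0_norm ?sqrtr_ge0.
Qed.

Lemma sum_notin_box_le C q a n (F : seq idx) :
  0 <= C -> 0 <= q -> q < 1 -> dominated C q a -> uniq F ->
  (forall k, k \in F -> (n <= absk k)%N) ->
  `|\sum_(k <- F) a k| <= tail C q n.
Proof.
move=> C0 q0 q1 aq uF Fn; have s1 := sqrt_lt1 q1.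
have s0 := sqrtr_ge0 q.
apply: (le_trans (ler_norm_sum _ _ _)).
apply: (@le_trans _ _ (\sum_(k <- F) C * (Num.sqrt q ^+ n * Num.sqrt q ^+ absk k))).
  rewrite big_seq [leRHS]big_seq; apply: ler_sum => k /Fn kn.
  apply: (le_trans (aq k)); apply: ler_wpM2l => //.
  rewrite -{1}(sqr_sqrtr q0) -exprM mulnC mulnS muln1 exprD.
  apply: ler_wpM2r; first exact: exprn_ge0.
  by apply: ler_wiXn2l => //; exact: ltW.
rewrite -mulr_sumr -mulr_sumr /tail; apply: ler_wpM2l => //.
rewrite mulrC; apply: ler_wpM2r; first exact: exprn_ge0.
exact: sum_geom_idx_le.
Qed.

Lemma partial_sum_psum_le C q a n (F : {fset idx}) :
  0 <= C -> 0 <= q -> q < 1 -> dominated C q a -> {subset box n <= F} ->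
  `|summability.partial_sum a F - psum a n| <= tail C q n.
Proof.
move=> C0 q0 q1 aq nF; rewrite psumE (bigID (mem (box n))) /=.
rewrite -[X in X + _ - _]big_filter (perm_big (box n)) /=; last first.
  apply: uniq_perm; rewrite ?filter_uniq ?fset_uniq ?box_uniq// => k.
  by rewrite mem_filter; case: (boolP (k \in box n)) => // /nF ->.
rewrite addrC addKr -big_filter; apply: sum_notin_box_le => //.
  by rewrite filter_uniq// fset_uniq.
by move=> k; rewrite mem_filter => /andP[/notin_box].
Qed.

Lemma near_totally_box n :
  \forall F \near @summability.totally idx, {subset box n <= F}.
Proof.
exists [fset k | k in box n]%fset => //= F /fsubsetP nF k kn.
by apply: nF; rewrite !inE.
Qed.

Lemma has_sum_unique a (s t : R) : has_sum a s -> has_sum a t -> s = t.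
Proof.
by move=> /(cvg_lim (@norm_hausdorff _ _)) <- /(cvg_lim (@norm_hausdorff _ _)).
Qed.

Lemma has_sum_psum_le C q a s n :
  0 <= C -> 0 <= q -> q < 1 -> dominated C q a -> has_sum a s ->
  `|s - psum a n| <= tail C q n.
Proof.
move=> C0 q0 q1 aq ahs.
have h : (fun F => `|summability.partial_sum a F - psum a n|) @
    @summability.totally idx --> `|s - psum a n|.
  by apply: cvg_norm; apply: cvgB => //; exact: cvg_cst.
apply: (cvgr_to_le h).
near=> F; apply: partial_sum_psum_le => //.
by near: F; exact: near_totally_box.
Unshelve. all: by end_near. Qed.

Lemma tail_lt C q e : q < 1 -> 0 < e -> exists n, tail C q n < e.
Proof.
move=> q1 e0; have [n _ nP] := cvgr_lt _ (tail_cvg C q1) _ e0.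
by exists n; apply: nP => /=.
Qed.

Lemma dominated_has_sum C q a :
  0 <= C -> 0 <= q -> q < 1 -> dominated C q a ->
  has_sum a (summability.sum a).
Proof.
move=> C0 q0 q1 aq; apply: cauchy_cvg. apply: cauchy_exP => e e0.
have [n ne] := tail_lt C q1 e0; exists (psum a n).
rewrite /nbhs /=; near=> F; rewrite -ball_normE /= distrC.
apply: le_lt_trans ne; apply: partial_sum_psum_le => //.
by near: F; exact: near_totally_box.
Unshelve. all: by end_near. Qed.

Lemma psum_cvg C q a s :
  0 <= C -> 0 <= q -> q < 1 -> dominated C q a -> has_sum a s ->
  psum a @ \oo --> s.
Proof.
move=> C0 q0 q1 aq ahs; apply/cvgrPdist_le => e e0.
near=> n; apply: (le_trans (has_sum_psum_le n C0 q0 q1 aq ahs)).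
by near: n; exact: cvgr_le _ (tail_cvg C q1) _ e0.
Unshelve. all: by end_near. Qed.

Lemma has_sum0 : has_sum (fun=> 0 : R) 0.
Proof.
rewrite /has_sum; have -> : summability.partial_sum (fun _ : idx => 0 : R) =
    fun=> 0; last exact: cvg_cst.
by apply/funext => F; rewrite psumE big1.
Qed.

Lemma has_sumD a b s t :
  has_sum a s -> has_sum b t -> has_sum (fun k => a k + b k) (s + t).
Proof.
move=> ahs bht; rewrite /has_sum.
suff -> : summability.partial_sum (fun k => a k + b k) =
    summability.partial_sum a \+ summability.partial_sum b by exact: cvgD.
by apply/funext => F /=; rewrite !psumE big_split.
Qed.

Lemma has_sum_sum (I : Type) (r : seq I) (a : I -> idx -> R) (s : I -> R) :
  (forall i, has_sum (a i) (s i)) ->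
  has_sum (fun k => \sum_(i <- r) a i k) (\sum_(i <- r) s i).
Proof.
move=> ahs; elim: r => [|i r ih].
  by under eq_fun do rewrite big_nil; rewrite big_nil; exact: has_sum0.
by under eq_fun do rewrite big_cons; rewrite big_cons; exact: has_sumD.
Qed.

(** Dominated convergence for series along an arbitrary filter: outside a large box both sums are
    uniformly small, inside it the sum is finite. It yields the continuity of the series as well as
    their termwise derivatives. *)
Lemma tannery (T : Type) (F : set_system T) {FF : Filter F}
    (g : T -> idx -> R) (l : idx -> R) (s : T -> R) (s' C q : R) :
  0 <= C -> 0 <= q -> q < 1 ->
  (\forall h \near F, dominated C q (g h)) -> dominated C q l ->
  (\forall h \near F, has_sum (g h) (s h)) -> has_sum l s' ->
  (forall k, g h k @[h --> F] --> l k) -> s h @[h --> F] --> s'.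
Proof.
move=> C0 q0 q1 gq lq gs ls gl; apply/cvgrPdist_lt => e e0.
have e3 : 0 < e / 3 by rewrite divr_gt0.
have [n ne] := tail_lt C q1 e3.
have pl : psum (g h) n @[h --> F] --> psum l n.
  by rewrite /psum; apply: cvg_big => [|k _]; [exact: add_continuous|exact: gl].
near=> h.
have h1 : `|s h - psum (g h) n| <= tail C q n.
  apply: has_sum_psum_le => //; first by near: h.
  by near: h.
have h2 := has_sum_psum_le n C0 q0 q1 lq ls.
have h3 : `|psum l n - psum (g h) n| < e / 3.
  by near: h; exact: cvgr_dist_lt pl _ e3.
rewrite (_ : s' - s h = (s' - psum l n) + (psum l n - psum (g h) n)
  - (s h - psum (g h) n)); last by ring.
apply: (le_lt_trans (ler_normB _ _)).
apply: (le_lt_trans (lerD (ler_normD _ _) (lexx _))).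
lra.
Unshelve. all: by end_near. Qed.

End GeometricSums.

(** * Cauchy products *)

Section CauchyProduct.
Context {R : realType}.
Implicit Types (a b : idx -> R) (C q : R).

Definition convol a b (k : idx) := \sum_(p <- pairs k) a p.1 * b p.2.

(** Each term is at most [C * C' * q ^+ absk k], but the number of terms grows with [k]. Half of the
    rate is kept; the other half is weakened to [s ^+ absk p.1], which has a geometric sum because
    [p.1] determines [p]. *)
Lemma convol_dominated C C' q a b :
  0 <= C -> 0 <= C' -> 0 <= q -> q < 1 -> dominated C q a -> dominated C' q b ->
  dominated (C * C' * (1 - Num.sqrt q)^-1 ^+ 3) (Num.sqrt q) (convol a b).
Proof.
move=> C0 C'0 q0 q1 aq bq k; have s0 := sqrtr_ge0 q; have s1 := sqrt_lt1 q1.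
set s := Num.sqrt q in s0 s1 *.
apply: (le_trans (ler_norm_sum _ _ _)).
apply: (@le_trans _ _ (\sum_(p <- pairs k) C * C' * s ^+ absk k * s ^+ absk p.1)).
  rewrite big_seq [leRHS]big_seq; apply: ler_sum => p pk.
  rewrite normrM; apply: (le_trans (ler_pM _ _ (aq _) (bq _))) => //.
  rewrite mulrACA -[leRHS]mulrA; apply: ler_wpM2l; first exact: mulr_ge0.
  rewrite -exprD (absk_pairs pk) -(sqr_sqrtr q0) -exprM mulnC mulnS muln1 exprD.
  apply: ler_wpM2l; first exact: exprn_ge0.
  by apply: ler_wiXn2l => //; [exact: ltW|rewrite -(absk_pairs pk) leq_addr].
rewrite -mulr_sumr mulrAC; apply: ler_wpM2r; first exact: exprn_ge0.
apply: ler_wpM2l; first exact: mulr_ge0.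
rewrite -(big_map (fun p => p.1) predT (fun m => s ^+ absk m)).
apply: sum_geom_idx_le => //; rewrite map_inj_in_uniq ?pairs_uniq//.
move=> [m1 m2] [m1' m2']; rewrite !mem_pairs /= => /eqP <- /eqP e m11.
congr (_, _) => //; apply/ffunP => l; move/ffunP: e => /(_ l).
by rewrite !idx_addE m11 => /addnI.
Qed.

(** The difference consists of the pairs inside the box whose sum leaves it, and for these
    [absk p.1 + absk p.2] is at least [n]. *)
Lemma psum_convol_le C C' q a b n :
  0 <= C -> 0 <= C' -> 0 <= q -> q < 1 -> dominated C q a -> dominated C' q b ->
  `|psum a n * psum b n - psum (convol a b) n| <=
  C * C' * (1 - Num.sqrt q)^-1 ^+ 3 * (1 - Num.sqrt q)^-1 ^+ 3 * Num.sqrt q ^+ n.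
Proof.
move=> C0 C'0 q0 q1 aq bq; have s0 := sqrtr_ge0 q; have s1 := sqrt_lt1 q1.
set s := Num.sqrt q in s0 s1 *; set K := (1 - s)^-1 ^+ 3.
rewrite /psum /convol sum_box_pairs.
rewrite -boxX_sum (bigID (fun p => p.1 + p.2 \in box n)) /=.
under [X in _ + _ - X]eq_bigl do rewrite andbT.
rewrite addrC addKr; apply: (le_trans (ler_norm_sum _ _ _)).
apply: (@le_trans _ _ (\sum_(p <- [seq (m, m') | m <- box n, m' <- box n])
    C * C' * s ^+ n * (s ^+ absk p.1 * s ^+ absk p.2))).
  rewrite big_mkcond; apply: ler_sum => p _.
  have CC0 : 0 <= C * C' by exact: mulr_ge0.
  case: ifPn => [/notin_box|_]; last by rewrite !mulr_ge0// exprn_ge0.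
  rewrite abskD => pn; rewrite normrM.
  apply: (le_trans (ler_pM _ _ (aq _) (bq _))) => //.
  rewrite mulrACA -[leRHS]mulrA; apply: ler_wpM2l => //.
  rewrite -!exprD -(sqr_sqrtr q0) -exprM mulnC mulnS muln1.
  rewrite [leLHS]exprD [leRHS]exprD.
  apply: ler_wpM2r; first exact: exprn_ge0.
  by apply: ler_wiXn2l => //; exact: ltW.
have K_le : \sum_(k <- box n) s ^+ absk k <= K.
  by apply: sum_geom_idx_le => //; exact: box_uniq.
have S0 : 0 <= \sum_(k <- box n) s ^+ absk k.
  by apply: sumr_ge0 => k _; exact: exprn_ge0.
rewrite -mulr_sumr (boxX_sum n (fun k => s ^+ absk k) (fun k => s ^+ absk k)).
have h := ler_pM S0 S0 K_le K_le.
have -> : C * C' * K * K * s ^+ n = C * C' * s ^+ n * (K * K) by ring.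
by apply: ler_wpM2l => //; rewrite !mulr_ge0// exprn_ge0.
Qed.

Lemma has_sum_convol C C' q a b s t :
  0 <= C -> 0 <= C' -> 0 <= q -> q < 1 -> dominated C q a -> dominated C' q b ->
  has_sum a s -> has_sum b t -> has_sum (convol a b) (s * t).
Proof.
move=> C0 C'0 q0 q1 aq bq ahs bht.
have s0 := sqrtr_ge0 q; have s1 := sqrt_lt1 q1.
have K0 : 0 <= (1 - Num.sqrt q)^-1 ^+ 3.
  by rewrite exprn_ge0// invr_ge0 subr_ge0 ltW.
have CK0 : 0 <= C * C' * (1 - Num.sqrt q)^-1 ^+ 3 by rewrite mulr_ge0// mulr_ge0.
have cq := convol_dominated C0 C'0 q0 q1 aq bq.
have chs := dominated_has_sum CK0 s0 s1 cq.
suff -> : s * t = summability.sum (convol a b) by [].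
have pc := psum_cvg CK0 s0 s1 cq chs.
have pab : psum a n * psum b n @[n --> \oo] --> s * t.
  by apply: cvgM; [exact: psum_cvg aq ahs|exact: psum_cvg bq bht].
apply/eqP; rewrite -subr_eq0 -normr_le0.
have h : `|psum a n * psum b n - psum (convol a b) n| @[n --> \oo] -->
    `|s * t - summability.sum (convol a b)| by apply: cvg_norm; exact: cvgB.
set L := `|_ - _| in h *.
pose K := C * C' * (1 - Num.sqrt q)^-1 ^+ 3 * (1 - Num.sqrt q)^-1 ^+ 3.
have h' : K * Num.sqrt q ^+ n @[n --> \oo] --> (0 : R).
  rewrite -[0 : R](mulr0 K); apply: cvgMr.
  by apply: cvg_expr; rewrite ger0_norm.
by apply: (ler_cvg_to h h'); apply: nearW => n; exact: psum_convol_le.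
Qed.

End CauchyProduct.

(** * Uniqueness of the coefficients of an exponential series *)

Section CoefficientUniqueness.
Context {R : realType}.
Implicit Types (c : idx -> R) (C q : R).

(** After division by [r ^+ W k0] every other nonzero term keeps a factor [r], so the coefficient of
    least weight is at most [r * K] for all [r] between 0 and 1. *)
Lemma weighted_coef_eq0 C q c (W : idx -> nat) (k0 : idx) :
  0 <= C -> 0 <= q -> q < 1 -> dominated C q c ->
  (forall r, 0 < r -> r < 1 -> has_sum (fun k => c k * r ^+ W k) 0) ->
  (forall k : idx, k != k0 -> c k != 0 -> (W k0 < W k)%N) -> c k0 = 0.
Proof.
move=> C0 q0 q1 cq cW Wk0; set K := C * (1 - q)^-1 ^+ 3.
have K0 : 0 <= K by rewrite mulr_ge0// exprn_ge0// invr_ge0 subr_ge0 ltW.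
have main r : 0 < r -> r < 1 -> `|c k0| <= r * K.
  move=> r0 r1; rewrite -(ler_pM2r (exprn_gt0 (W k0) r0)).
  have h : `|c k0| * r ^+ W k0 -
        `|summability.partial_sum (fun k => c k * r ^+ W k) F|
      @[F --> summability.totally] --> `|c k0| * r ^+ W k0 - `|0 : R|.
    by apply: cvgB; [exact: cvg_cst|apply: cvg_norm; exact: cW].
  rewrite -[leLHS]subr0 -(normr0 R); apply: (cvgr_to_le h).
  exists [fset k0]%fset => //= F /=; rewrite fsub1set => k0F.
  rewrite psumE (big_fsetD1 k0)//= lerBlDr.
  rewrite -{1}(ger0_norm (exprn_ge0 (W k0) (ltW r0))) -normrM.
  set x := c k0 * _; set y := \sum_(k <- _) _.
  have := ler_normB (x + y) y; rewrite addrK => /le_trans; apply.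
  rewrite [leLHS]addrC. rewrite lerD2r /y.
  rewrite (_ : r * K * _ = C * r ^+ (W k0).+1 * (1 - q)^-1 ^+ 3); last first.
    by rewrite /K (exprS r (W k0)); ring.
  apply: (le_trans (ler_norm_sum _ _ _)).
  apply: (@le_trans _ _
      (\sum_(k <- (F `\ k0)%fset) C * r ^+ (W k0).+1 * q ^+ absk k)).
    rewrite big_seq [leRHS]big_seq; apply: ler_sum => k.
    rewrite !inE => /andP[kk0 _].
    have [->|ck] := eqVneq (c k) 0.
      by rewrite mul0r normr0 !mulr_ge0// exprn_ge0// ltW.
    rewrite normrM mulrAC ler_pM// (ger0_norm (exprn_ge0 _ (ltW r0))).
    by apply: ler_wiXn2l; [exact: ltW|exact: ltW|exact: Wk0].
  rewrite -mulr_sumr; apply: ler_wpM2l; first by rewrite mulr_ge0// exprn_ge0// ltW.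
  by apply: sum_geom_idx_le => //; exact: fset_uniq.
apply/eqP; rewrite -normr_le0 leNgt; apply/negP => ck0.
have cK0 : 0 < 2 * `|c k0| + 2 * K by lra.
(* This value of [r] is below 1 and would force [2 * |c k0| + 2 * K <= K]. *)
have r0 : 0 < `|c k0| / (2 * `|c k0| + 2 * K) by rewrite divr_gt0.
have r1 : `|c k0| / (2 * `|c k0| + 2 * K) < 1 by rewrite ltr_pdivrMr// mul1r; lra.
have := main _ r0 r1; rewrite mulrAC ler_pdivlMr// ler_pM2l//; lra.
Qed.

Definition o0 : 'I_3 := ord0.
Definition o1 : 'I_3 := lift ord0 ord0.
Definition o2 : 'I_3 := lift ord0 (lift ord0 ord0).

Lemma sum3 (V : nmodType) (F : 'I_3 -> V) : \sum_l F l = F o0 + F o1 + F o2.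
Proof. by rewrite !big_ord_recl big_ord0 addr0 addrA. Qed.

Lemma abskE (k : idx) : absk k = (k o0 + k o1 + k o2)%N.
Proof. by rewrite /absk !big_ord_recl big_ord0 addn0 addnA. Qed.

Lemma idx_eqP (k m : idx) : k o0 = m o0 -> k o1 = m o1 -> k o2 = m o2 -> k = m.
Proof.
move=> h0 h1 h2; apply/ffunP => -[[|[|[|//]]] il].
- by rewrite (_ : Ordinal il = o0)//; apply/val_inj.
- by rewrite (_ : Ordinal il = o1)//; apply/val_inj.
- by rewrite (_ : Ordinal il = o2)//; apply/val_inj.
Qed.

(* The linear weight [W] has its minimum over any degree-[>= n] support in degree
   [n], and is injective there; so along [x = - ln r *: w] a single monomial
   dominates as [r] tends to [0]. *)
Lemma has_sum_phi_eq0 C q c :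
  0 <= C -> 0 <= q -> q < 1 -> dominated C q c ->
  (forall x, orthant x -> has_sum (fun k => c k * phi k x) 0) ->
  forall k : idx, c k = 0.
Proof.
move=> C0 q0 q1 cq cphi k.
have [n nk] := ubnP (absk k); elim: n k nk => // n ihn k.
rewrite ltnS leq_eqVlt => /predU1P[kn|]; last exact: ihn.
(* In degree [n] the secondary weight [m1 + (n + 1) m2] is at most [n (n + 1)], so the factor [D]
   ranks by degree first; digits in base [n + 1] then separate the indices of degree [n]. *)
pose D := (n * n.+1).+1.
pose W (m : idx) := (D * absk m + (m o1 + n.+1 * m o2))%N.
have [w wk] := ubnP (W k); elim: w k kn wk => // w ihw k kn; rewrite ltnS => wk.
apply: (@weighted_coef_eq0 C q c W k C0 q0 q1 cq) => [r r0 r1|m mk cm].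
  pose wt (l : 'I_3) : nat :=
    (D + (if l == o1 then 1 else if l == o2 then n.+1 else 0))%N.
  pose x : 'rV[R]_3 := \row_l (- ln r * (wt l)%:R).
  have xo : orthant x.
    by move=> l; rewrite mxE mulr_ge0// oppr_ge0 ln_le0// ltW.
  have -> : (fun m => c m * r ^+ W m) = fun m => c m * phi m x.
    apply/funext => m; congr (_ * _).
    rewrite /phi sum3 !mxE /W /wt abskE -{1}(lnK r0) -expRM_natl.
    move: (D) (n.+1) => d N /=; congr expR.
    by rewrite !natrD !natrM !natrD addr0; ring.
  exact: cphi.
rewrite ltnNge; apply/negP => Wm; move/eqP: cm; apply.
(* Indices of smaller degree, or of equal degree and smaller weight, have coefficient zero by the
   two inductions. *)
have [mn|nm|mn] := ltngtP (absk m) n.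
- exact: ihn.
- exfalso; have : (absk k = n)%N by []; move: Wm nm; rewrite /W /D => + + kn'.
  rewrite kn'; have := leq_absk k o1; have := leq_absk k o2.
  have := abskE k; rewrite kn' => h; move: h; set a := absk m.
  move: (k o0) (k o1) (k o2) (m o1) (m o2) => k0 k1 k2 m1 m2; nia.
- have [Wlt|] := ltnP (W m) (W k); first by apply: ihw => //; exact: leq_trans wk.
  move=> Wle; exfalso; move/eqP: mk; apply.
  have : W m = W k by apply/eqP; rewrite eqn_leq Wm.
  rewrite /W mn kn => /eqP; rewrite eqn_add2l => /eqP.
  move: mn kn; rewrite !abskE => mn kn e.
  have [m1n k1n] : (m o1 < n.+1)%N /\ (k o1 < n.+1)%N by split; lia.
  have e2 : m o2 = k o2.
    move/(congr1 (divn^~ n.+1)): e => /=; rewrite !(mulnC n.+1).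
    by rewrite !(addnC _ (_ * _)%N) !divnMDl// !divn_small// !addn0.
  by move: e; rewrite e2 => /addIn e1; apply: idx_eqP => //; lia.
Qed.

End CoefficientUniqueness.

(** * Termwise calculus of exponential series on the orthant *)

Section ExponentialSeries.
Context {R : realType}.
Implicit Types (a : idx -> R) (C q t : R) (x : 'rV[R]_3).

Lemma phi_gt0 k x : 0 < phi k x.
Proof. exact: expR_gt0. Qed.

Lemma phi_exponent_ge0 (k : idx) x :
  orthant x -> 0 <= \sum_(l < 3) (k l)%:R * x ord0 l.
Proof. by move=> xo; apply: sumr_ge0 => l _; rewrite mulr_ge0// xo. Qed.

Lemma phi_le1 k x : orthant x -> phi k x <= 1.
Proof. by move=> xo; rewrite -expR0 ler_expR oppr_le0 phi_exponent_ge0. Qed.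

Lemma phiD (k m : idx) x : phi (k + m) x = phi k x * phi m x.
Proof.
rewrite /phi -expRD -opprD -big_split; congr (expR (- _)).
by apply: eq_bigr => l _; rewrite idx_addE natrD mulrDl.
Qed.

Lemma e_E (i l : 'I_3) : (e_ i : 'rV[R]_3) ord0 l = (l == i)%:R.
Proof. by rewrite mxE. Qed.

Lemma shiftE x (i l : 'I_3) h :
  (x + h *: e_ i) ord0 l = x ord0 l + h * (l == i)%:R.
Proof. by rewrite mxE [X in _ + X]mxE e_E. Qed.

Lemma phi_shift (k : idx) x i h :
  phi k (x + h *: e_ i) = phi k x * expR (- ((k i)%:R * h)).
Proof.
rewrite /phi -expRD -opprD (bigD1 i)//= [in RHS](bigD1 i)//=.
rewrite (eq_bigr (fun l => (k l)%:R * x ord0 l)) => [|l li].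
  by rewrite shiftE eqxx mulr1 mulrDr addrAC.
by rewrite shiftE (negbTE li) mulr0 addr0.
Qed.

Lemma continuous_phi k : continuous (@phi R k).
Proof.
move=> x; rewrite /phi; apply: continuous_comp; last exact: continuous_expR.
have h : \sum_(l < 3) (k l)%:R * (y : 'rV[R]_3) ord0 l @[y --> x] -->
    \sum_(l < 3) (k l)%:R * x ord0 l.
  apply: (@cvg_big _ _ _ _ _ _ 'rV[R]_3 (nbhs x)) => [|l _].
    exact: add_continuous.
  apply: (@cvgMr R 'rV[R]_3 (nbhs x)); exact: (@coord_continuous R 1 3 ord0 l x).
exact: cvgN h.
Qed.

Lemma dominated_mul_phi C q a x : orthant x -> dominated C q a ->
  dominated C q (fun k => a k * phi k x).
Proof.
move=> xo aq k; rewrite normrM (ger0_norm (ltW (phi_gt0 k x))).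
by apply: le_trans (aq k); rewrite ler_piMr// phi_le1.
Qed.

Lemma convol_mul_phi (a b : idx -> R) x :
  convol (fun k => a k * phi k x) (fun k => b k * phi k x) =
  fun k => convol a b k * phi k x.
Proof.
apply/funext => k; rewrite /convol mulr_suml big_seq [RHS]big_seq.
by apply: eq_bigr => p; rewrite mem_pairs => /eqP <-; rewrite phiD mulrACA.
Qed.

Lemma nat_mul_expr_le q n : 0 <= q -> q < 1 -> n%:R * q ^+ n <= (1 - q)^-1.
Proof.
move=> q0 q1; apply: le_trans (geom_sum_le n q0 q1).
rewrite mulr_natl -[X in _ *+ X](card_ord n) -sumr_const.
by apply: ler_sum => i _; apply: ler_wiXn2l => //; [exact: ltW|exact: ltnW].
Qed.

Lemma dominated_mul_absk C q a : 0 <= C -> 0 <= q -> q < 1 -> dominated C q a ->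
  dominated (C * (1 - Num.sqrt q)^-1) (Num.sqrt q) (fun k => (absk k)%:R * a k).
Proof.
move=> C0 q0 q1 aq k; have s0 := sqrtr_ge0 q; have s1 := sqrt_lt1 q1.
rewrite normrM ger0_norm//; apply: (le_trans (ler_wpM2l _ (aq k))) => //.
rewrite -{1}(sqr_sqrtr q0) -exprM mulnC mulnS muln1 exprD.
rewrite mulrCA -mulrA; apply: ler_wpM2l => //; rewrite mulrA.
by apply: ler_wpM2r; [exact: exprn_ge0|exact: nat_mul_expr_le].
Qed.

Lemma dominated_le C q a b : (forall k, `|b k| <= `|a k|) -> dominated C q a ->
  dominated C q b.
Proof. by move=> ba aq k; exact: le_trans (ba k) (aq k). Qed.

Lemma expRN_dist_le (u v : R) : 0 <= u -> 0 <= v ->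
  `|expR (- u) - expR (- v)| <= `|u - v|.
Proof.
wlog uv : u v / u <= v => [h u0 v0|u0 v0].
  have [uv|/ltW vu] := leP u v; first exact: h.
  by rewrite distrC [leRHS]distrC; exact: h.
rewrite ger0_norm ?subr_ge0 ?ler_expR ?lerN2// ler0_norm ?subr_le0//.
rewrite (_ : - v = - u + - (v - u)); last by ring.
rewrite expRD; have e1 := expR_ge1Dx (- (v - u)).
have e2 : expR (- u) <= 1 by rewrite -expR0 ler_expR oppr_le0.
have e3 := expR_gt0 (- u); nra.
Qed.

Section WithinDnbhs.
Context {V : normedModType R} (D : set V).

(** Identifying the value of [derive_in] needs a proper filter; admissible positive increments
    provide it even at boundary points of [D]. *)
Lemma within_dnbhs_proper (a v : V) :
  (forall h : R, 0 < h -> D (a + h *: v)) ->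
  ProperFilter (within [set h : R | D (a + h *: v)] 0^').
Proof.
move=> Dh; apply: Build_ProperFilter_ex => P.
rewrite /within /= => /nbhs_ballP[e /= e0 eP].
exists (e / 2); apply: eP => /=.
- by rewrite /ball /= sub0r normrN gtr0_norm ?divr_gt0// gtr_pMr// invf_lt1// ltr1n.
- by rewrite gt_eqF// divr_gt0.
- by apply: Dh; rewrite divr_gt0.
Qed.

End WithinDnbhs.

Lemma near_within_dnbhs (A : set R) :
  \forall h \near within A 0^', h != 0 /\ A h.
Proof.
rewrite near_withinE; near=> h => Ah; split=> //.
by near: h; exact: nbhs_dnbhs_neq.
Unshelve. all: by end_near. Qed.

Lemma orthant_shift x i (h : R) : orthant x -> 0 < h -> orthant (x + h *: e_ i).
Proof.
by move=> xo h0 l; rewrite shiftE addr_ge0// ?xo// mulr_ge0// ltW.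
Qed.

Lemma derive_in_eq {V : normedModType R} (D : set V) (f : V -> R) (a v : V) l :
  (forall h : R, 0 < h -> D (a + h *: v)) ->
  h^-1 *: (f (a + h *: v) - f a)
    @[h --> within [set h | D (a + h *: v)] 0^'] --> (l : R) ->
  derivable_in D f a v /\ derive_in D f a v = l.
Proof.
move=> Dh fl; split; first by apply/cvg_ex; exists l.
by have pf := within_dnbhs_proper Dh; apply: (cvg_lim (@norm_hausdorff _ _)).
Qed.

Lemma is_derive_cvg_within (g : R -> R) t dg (A : set R) :
  is_derive t 1 g dg ->
  h^-1 *: (g (t + h *: 1) - g t) @[h --> within A 0^'] --> dg.
Proof.
move=> [gd <-]; apply: cvg_within_filter.
suff -> : (fun h => h^-1 *: (g (t + h *: 1) - g t)) =
    fun h => h^-1 *: ((g \o shift t) (h *: 1) - g t) by exact: gd.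
by apply/funext => h /=; rewrite [t + _]addrC.
Qed.

Lemma is_derive_expR_mul (c t : R) :
  is_derive t 1 (fun h => expR (c * h)) (c * expR (c * t)).
Proof.
have d : is_derive t 1 (c \*: id : R -> R) (c *: 1) by exact: is_deriveZ.
have := is_derive1_comp (is_derive_expR (c * t)) d.
by rewrite [c *: 1]mulr1 mulrC.
Qed.

Lemma is_derive_mull (c : R) (f : R -> R) t df :
  is_derive t 1 f df -> is_derive t 1 (fun h => c * f h) (c * df).
Proof. by move=> d; exact: (is_deriveZ c). Qed.

Lemma is_derive_mul (f g : R -> R) t df dg :
  is_derive t 1 f df -> is_derive t 1 g dg ->
  is_derive t 1 (fun h => f h * g h) (f t * dg + g t * df).
Proof. by move=> d d'; exact: is_deriveM. Qed.

Lemma is_derive_mulr (c : R) (f : R -> R) t df :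
  is_derive t 1 f df -> is_derive t 1 (fun h => f h * c) (df * c).
Proof.
by move=> /(is_derive_mull c); rewrite mulrC; under eq_fun do rewrite mulrC.
Qed.

Lemma phi_lipschitz k x i h : orthant x -> orthant (x + h *: e_ i) ->
  `|phi k (x + h *: e_ i) - phi k x| <= (absk k)%:R * `|h|.
Proof.
move=> xo xho.
apply: le_trans (expRN_dist_le (phi_exponent_ge0 k xho) (phi_exponent_ge0 k xo)) _.
rewrite -sumrB (bigD1 i)//= big1 => [|l li]; last first.
  by rewrite shiftE (negbTE li) mulr0 addr0 subrr.
rewrite addr0 shiftE eqxx mulr1 -mulrBr [_ + h]addrC addrK normrM ger0_norm//.
by apply: ler_wpM2r => //; rewrite ler_nat leq_absk.
Qed.

Lemma has_sumZ a s (c : R) : has_sum a s -> has_sum (fun k => c * a k) (c * s).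
Proof.
move=> ahs; rewrite /has_sum; suff -> : summability.partial_sum (fun k => c * a k) =
    fun F => c * summability.partial_sum a F by exact: cvgMr.
by apply/funext => F; rewrite !psumE mulr_sumr.
Qed.

Lemma has_sum_quotient (a b : idx -> R) s t (h : R) :
  has_sum a s -> has_sum b t ->
  has_sum (fun k => h^-1 *: (a k - b k)) (h^-1 *: (s - t)).
Proof.
move=> ahs bht; apply: has_sumZ; rewrite -[- t]mulN1r.
under eq_fun do rewrite -mulN1r.
by apply: has_sumD => //; exact: has_sumZ.
Qed.

(** [tannery] for the difference quotients: within the orthant [phi k] is [absk k]-Lipschitz along
    [e_ i], so they are dominated by [absk k * |a k|], which still decays at the rate
    [Num.sqrt q]. *)
Lemma partial_has_sum C q a (f : 'rV[R]_3 -> R) i x s :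
  0 <= C -> 0 <= q -> q < 1 -> dominated C q a ->
  (forall y, orthant y -> has_sum (fun k => a k * phi k y) (f y)) ->
  orthant x -> has_sum (fun k => - (k i)%:R * a k * phi k x) s ->
  partial_derivable i f x /\ partial i f x = s.
Proof.
move=> C0 q0 q1 aq fs xo hs.
have s0 := sqrtr_ge0 q; have s1 := sqrt_lt1 q1.
apply: derive_in_eq => [h|]; first exact: orthant_shift.
have aq' := dominated_mul_absk C0 q0 q1 aq.
have C'0 : 0 <= C * (1 - Num.sqrt q)^-1.
  by rewrite mulr_ge0// invr_ge0 subr_ge0 ltW.
apply: (@tannery R R _ _ (fun h k =>
  h^-1 *: (a k * phi k (x + h *: e_ i) - a k * phi k x)) _ _ _ _ _
  C'0 s0 s1 _ _ _ hs) => [|||k].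
- apply: filterS (near_within_dnbhs _) => h [h0 xho].
  apply: dominated_le aq' => k; rewrite -mulrBr normrZ normfV.
  rewrite ler_pdivrMl ?normr_gt0// !normrM [ `|(absk k)%:R|]ger0_norm//.
  rewrite mulrA [_ * (absk k)%:R]mulrC [leRHS]mulrC.
  by apply: ler_wpM2l => //; exact: phi_lipschitz.
- apply: dominated_le aq' => k.
  rewrite !normrM normrN !normr_nat (ger0_norm (ltW (phi_gt0 k x))).
  rewrite -[leRHS]mulr1; apply: ler_pM;
    rewrite ?mulr_ge0// ?(ltW (phi_gt0 _ _)) ?phi_le1//.
  by apply: ler_wpM2r => //; rewrite ler_nat leq_absk.
- apply: filterS (near_within_dnbhs _) => h [h0 xho].
  by apply: has_sum_quotient; apply: fs.
- have d : is_derive (0 : R) 1 (fun h => a k * (phi k x * expR (- (k i)%:R * h)))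
      (- (k i)%:R * a k * phi k x).
    apply: (is_derive_eq (is_derive_mull (a k) (is_derive_mull (phi k x)
      (is_derive_expR_mul (- (k i)%:R) 0)))).
    by rewrite mulr0 expR0; ring.
  have := is_derive_cvg_within [set h | orthant (x + h *: e_ i)] d.
  apply: cvg_trans; apply: near_eq_cvg; near=> h.
  by rewrite phi_shift add0r !mulr0 expR0 mulr1 [h *: 1]mulr1 mulNr.
Unshelve. all: by end_near. Qed.

Lemma is_derive_continuous (f df : R -> R) :
  (forall t, is_derive t 1 f (df t)) -> continuous f.
Proof.
move=> d t; apply: differentiable_continuous; apply/derivable1_diffP.
by have [] := d t.
Qed.

Lemma lipschitz_halfline (f df : R -> R) (M s t : R) :
  (forall t, is_derive t 1 f (df t)) -> (forall t, 0 <= t -> `|df t| <= M) ->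
  0 <= s -> 0 <= t -> `|f s - f t| <= M * `|s - t|.
Proof.
move=> d dM; wlog st : s t / s <= t => [h s0 t0|s0 t0].
  have [st|/ltW ts] := leP s t; first exact: h.
  by rewrite distrC [ `|s - t|]distrC; exact: h.
have [|c] := @MVT_segment R f df s t st (fun u _ => d u).
  by apply: continuous_subspaceT; exact: is_derive_continuous d.
rewrite in_itv /= => /andP[sc _] e.
rewrite distrC e normrM distrC; apply: ler_wpM2r => //; apply: dM.
exact: le_trans sc.
Qed.

(** Here the quotients are dominated through the mean value theorem, by the bound on [da] that is
    uniform over the half-line. *)
Lemma time_has_sum C q (a da : idx -> R -> R) (f : R -> R) x t s :
  0 <= C -> 0 <= q -> q < 1 -> orthant x ->
  (forall k t, is_derive t 1 (a k) (da k t)) ->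
  (forall t, 0 <= t -> dominated C q (da ^~ t)) ->
  (forall t, 0 <= t -> has_sum (fun k => a k t * phi k x) (f t)) ->
  0 <= t -> has_sum (fun k => da k t * phi k x) s ->
  time_derivable f t /\ time_derive f t = s.
Proof.
move=> C0 q0 q1 xo ad daq fs t0 hs.
apply: derive_in_eq => [h h0|].
  by rewrite /halfline /= [h *: 1]mulr1 addr_ge0// ltW.
apply: (@tannery R R _ _ (fun h k =>
  h^-1 *: (a k (t + h *: 1) * phi k x - a k t * phi k x)) _ _ _ _ _
  C0 q0 q1 _ _ _ hs) => [|||k].
- apply: filterS (near_within_dnbhs _) => h [h0 tho] k.
  rewrite -mulrBl normrZ normfV ler_pdivrMl ?normr_gt0// normrM.
  rewrite [ `|phi k x|]ger0_norm ?(ltW (phi_gt0 _ _))//.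
  rewrite -[leRHS]mulr1; apply: ler_pM => //; rewrite ?(ltW (phi_gt0 _ _)) ?phi_le1//.
  rewrite mulrC; apply: le_trans (lipschitz_halfline (ad k) _ tho t0) _ => [u u0|].
    exact: daq.
  by rewrite [t + _]addrC addrK [h *: 1]mulr1.
- exact: dominated_mul_phi (daq t t0).
- apply: filterS (near_within_dnbhs _) => h [h0 tho].
  by apply: has_sum_quotient; apply: fs.
- exact: (is_derive_cvg_within _ (is_derive_mulr (phi k x) (ad k t))).
Qed.

Lemma time_derive_eq (g : R -> R) t dg : 0 <= t -> is_derive t 1 g dg ->
  time_derivable g t /\ time_derive g t = dg.
Proof.
move=> t0 d; apply: derive_in_eq => [h h0|]; last exact: is_derive_cvg_within.
by rewrite /halfline /= [h *: 1]mulr1 addr_ge0// ltW.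
Qed.

(** The representative [a'], continuous on the whole line, is there for coefficients such as
    one-sided time derivatives, which are controlled only for [t >= 0]. *)
Lemma series_expansionI C q (F : 'rV[R]_3 -> R -> R) (a a' : idx -> R -> R) :
  0 <= C -> 0 <= q -> q < 1 ->
  (forall k, continuous (a' k)) -> (forall k t, 0 <= t -> a k t = a' k t) ->
  (forall t, 0 <= t -> dominated C q (a ^~ t)) ->
  (forall x t, orthant x -> 0 <= t -> has_sum (fun k => a k t * phi k x) (F x t)) ->
  series_expansion F a.
Proof.
move=> C0 q0 q1 a'c aa' aq Fs.
have term k : continuous_spacetime (fun x t => a k t * phi k x).
  apply/subspace_continuousP => -[x t] [/= xo t0].
  have h : (a' k z.2 * phi k z.1)
        @[z --> within (orthant `*` halfline) (nbhs (x, t))]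
      --> a' k t * phi k x.
    apply: cvg_within_filter; apply: cvgM.
      by apply: (cvg_comp _ (a' k)); [exact: cvg_snd|exact: a'c].
    by apply: (cvg_comp _ (phi k)); [exact: cvg_fst|exact: continuous_phi].
  rewrite /from_subspace /= aa'//; move: h; apply: cvg_trans; apply: near_eq_cvg.
  by rewrite near_withinE; near=> z => -[zo z0]; rewrite aa'.
split=> //; apply/subspace_continuousP => -[x t] [/= xo t0].
apply: (@tannery R _ _ _ (fun z k => a k z.2 * phi k z.1) _ _ _ _ _
  C0 q0 q1 _ _ _ (Fs x t xo t0)) => [|||k].
- rewrite near_withinE; near=> z => -[zo z0].
  by apply: dominated_mul_phi => //; exact: aq.
- by apply: dominated_mul_phi => //; exact: aq.
- by rewrite near_withinE; near=> z => -[zo z0]; exact: Fs.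
- by have /subspace_continuousP/(_ (x, t)) := term k; apply; split.
Unshelve. all: by end_near. Qed.

End ExponentialSeries.

(** * Recursion on the degree *)

(** Since [F] looks only at smaller degrees, the value at [k] of its iterates is settled after
    [absk k + 1] steps. Both the majorant and the polynomial modes are built this way. *)
Lemma graded_fixpoint (X : Type) (x0 : X) (F : (idx -> X) -> idx -> X) :
  (forall f g k, (forall m, (absk m < absk k)%N -> f m = g m) -> F f k = F g k) ->
  exists f, forall k, f k = F f k.
Proof.
move=> Floc; pose it n := iter n F (fun=> x0).
have itE n m k : (absk k < n)%N -> (absk k < m)%N -> it n k = it m k.
  elim: n m k => // n ihn [//|m] k kn km; apply: Floc => k' k'k.
  by apply: ihn; [exact: leq_trans k'k kn|exact: leq_trans k'k km].
exists (fun k => it (absk k).+1 k) => k; apply: Floc => m mk.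
exact: itE.
Qed.

Definition nzpair (p : idx * idx) := (p.1 != 0) && (p.2 != 0).

Lemma nzpair_absk (k : idx) p : p \in pairs k -> nzpair p ->
  (absk p.1 < absk k)%N /\ (absk p.2 < absk k)%N.
Proof.
move=> /absk_pairs <- /andP[]; rewrite -!absk_gt0 => p1 p2.
by move: (absk p.1) (absk p.2) p1 p2 => a b a0 b0; split; lia.
Qed.

(** * Tree function weights and the scalar majorant *)

Section TreeWeights.
Context {R : realType}.

(** [n ^ n.-1] counts the rooted labelled trees on [n] vertices. The value 1 at 0 makes vanishing
    coordinates neutral in the product over coordinates. *)
Definition tree_weight (n : nat) : R :=
  if n is 0 then 1 else expR (- n%:R) * ((n ^ n.-1)%N%:R / (n`!)%:R).

(** For [n > 0] this is [n * tree_weight n]. By Stirling it decreases like n^(-1/2), so its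
    differences are of the order n^(-3/2) of the weights and can be telescoped against them. *)
Let g (n : nat) : R := expR (- n%:R) * ((n ^ n)%N%:R / (n`!)%:R).

Lemma sinh_ge (s : R) : 0 <= s -> 2 * s <= expR s - expR (- s).
Proof.
move=> s0; pose f (u : R) := expR (1 * u) + (- 1 * expR (- 1 * u) + - 2 * u).
have fd (u : R) : is_derive u 1 f
    (1 * expR (1 * u) + (- 1 * (- 1 * expR (- 1 * u)) + - 2 * 1)).
  apply: is_deriveD; first exact: is_derive_expR_mul.
  apply: is_deriveD; exact/is_derive_mull/is_derive_expR_mul.
have [|c] := @MVT_segment R f _ 0 s s0 (fun u _ => fd u).
  by apply: continuous_subspaceT; exact: is_derive_continuous fd.
move=> _; rewrite /f !mul1r !mulN1r mulr0 oppr0 expR0 opprK => h.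
have e := expRxMexpNx_1 c; have ec := expR_gt0 c; have ecN := expR_gt0 (- c).
have sq := sqr_ge0 (expR c - 1).
have : 0 <= expR c + (expR (- c) + - 2 * 1) by nra.
by move=> /mulr_ge0 /(_ s0); lra.
Qed.

(** This is [s <= sinh s] at [s = ln y]. Unlike [ln y <= y - 1] it is exact to second order at
    [y = 1], the order that [g_step] needs. *)
Lemma ln_le_half (y : R) : 1 <= y -> ln y <= (y - y^-1) / 2.
Proof.
move=> y1; have y0 : 0 < y by exact: lt_le_trans y1.
have := sinh_ge (ln_ge0 y1); rewrite expRN lnK//; lra.
Qed.

(** For [m > 0] the quotient [g m / g m.+1] is e divided by (1 + 1/m)^m, so the claim is (1 + 1/m)^m
    (1 + d) <= e with d = 1 / (2 (m + 1)). *)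
Lemma g_step (m : nat) : g m.+1 * (1 + (2 * m.+1%:R)^-1) <= g m.
Proof.
have fne : (m`!)%:R != 0 :> R by rewrite pnatr_eq0 -lt0n fact_gt0.
have mne : m.+1%:R != 0 :> R by rewrite pnatr_eq0.
have gS : g m.+1 = expR (- m%:R) * expR (- 1) * (m.+1%:R ^+ m / (m`!)%:R).
  rewrite /g -expRD -opprD -natr1 factS natrM expnS natrM natrX -natr1.
  rewrite -natr1 in mne; congr (_ * _); field.
  by rewrite fne mne.
rewrite gS /g natrX.
have h : m.+1%:R ^+ m * (1 + (2 * m.+1%:R)^-1) <= m%:R ^+ m * expR 1 :> R.
  case: m fne mne gS => [_ _ _|m _ _ _].
    by rewrite !expr0 !mul1r mulr1; have := expR_ge1Dx (1 : R); lra.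
  set M := m.+1%:R : R; have M0 : 0 < M by rewrite ltr0n.
  rewrite -[m.+2%:R]natr1 -/M; set d := (2 * (M + 1))^-1.
  pose y := (M + 1) / M; have y0 : 0 < y by rewrite divr_gt0// addr_gt0.
  have y1 : 1 <= y by rewrite ler_pdivlMr// mul1r lerDl.
  have -> : M + 1 = M * y by rewrite /y mulrC divfK// gt_eqF.
  rewrite exprMn -mulrA ler_pM2l ?exprn_gt0//.
  (* [ln_le_half] bounds the exponent [M * ln y] by exactly [1 - d], and the correction [1 + d] is
     at most [expR d]. *)
  have -> : expR 1 = expR (1 - d) * expR d :> R by rewrite -expRD subrK.
  apply: ler_pM; rewrite ?exprn_ge0 ?(ltW y0) ?expR_ge1Dx//.
    by rewrite addr_ge0// invr_ge0 mulr_ge0// addr_ge0// ltW.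
  rewrite -{1}(lnK y0) -expRM_natl ler_expR -/M.
  have := ler_wpM2l (ltW M0) (ln_le_half y1).
  suff -> : M * ((y - y^-1) / 2) = 1 - d by [].
  rewrite /y /d; field.
  by have m0 := ler0n R m; apply/andP; split; rewrite gt_eqF//; lra.
have e := expRxMexpNx_1 (1 : R); have e0 := expR_gt0 (1 : R).
have i0 : 0 < (m`!)%:R^-1 :> R by rewrite invr_gt0 ltr0n fact_gt0.
rewrite (_ : _ * _ = expR (- m%:R) * (m`!)%:R^-1 * expR (- 1) *
  (m.+1%:R ^+ m * (1 + (2 * m.+1%:R)^-1))); last first.
  by field; rewrite addrC natr1 mne fne.
have -> : expR (- m%:R) * (m%:R ^+ m / (m`!)%:R) =
    expR (- m%:R) * (m`!)%:R^-1 * expR (- 1) * (m%:R ^+ m * expR 1) :> R.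
  by rewrite -[LHS]mulr1 -[X in _ * X = _]e; ring.
by apply: ler_wpM2l => //; rewrite !mulr_ge0 ?expR_ge0// ltW.
Qed.

Lemma tree_weight_ge0 n : 0 <= tree_weight n.
Proof.
by case: n => [//|n]; rewrite /tree_weight mulr_ge0 ?expR_ge0// divr_ge0.
Qed.

Lemma tree_weightS_le m : tree_weight m.+1 <= 2 * (g m - g m.+1).
Proof.
have := g_step m; have -> : tree_weight m.+1 = g m.+1 / m.+1%:R.
  rewrite /tree_weight /g expnS natrM /=; field.
  by rewrite addrC natr1 !pnatr_eq0 /= -lt0n; exact: (fact_gt0 m.+1).
rewrite mulrDr mulr1 invfM mulrCA; move: (g m.+1) (g m) => u w.
move: (u / _) => v.
lra.
Qed.

(** Telescoping bounds the terms of positive index by [2 * g 0 = 2]. Their full series is 1, the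
    value of the tree function at 1/e, but 2 is enough for what follows. *)
Lemma sum_tree_weight_le n : \sum_(i < n) tree_weight i <= 3.
Proof.
case: n => [|n]; first by rewrite big_ord0.
rewrite big_ord_recl /=.
have : \sum_(i < n) tree_weight (bump 0 i) <= 2 * (g 0 - g n).
  elim: n => [|n ih]; first by rewrite big_ord0 subrr mulr0.
  by rewrite big_ord_recr /=; have := tree_weightS_le n; rewrite /bump /=; lra.
have : 0 <= g n by rewrite mulr_ge0 ?expR_ge0// divr_ge0.
by rewrite {2}/g oppr0 expR0 expn0 fact0 divr1 mulr1; lra.
Qed.

Definition tree_coef (k : idx) : R := 10^-1 ^+ 3 * \prod_l tree_weight (k l).

Lemma tree_coef_ge0 k : 0 <= tree_coef k.
Proof. by rewrite mulr_ge0// ?prodr_ge0// => l _; exact: tree_weight_ge0. Qed.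

(* [24^-1 = (4 * 6)^-1] is the largest [c] for which [x |-> c + 6 * x ^+ 2] has a
   fixed point, [12^-1]. *)
Lemma sum_tree_coef_le n :
  \sum_(k <- box n | k != 0) tree_coef k <= 24^-1.
Proof.
case: n => [|n].
  rewrite (_ : box 0 = [::]) ?big_nil//.
  by apply/size0nil; rewrite size_map -cardE card_ffun !card_ord.
have b0 : (0 : idx) \in box n.+1.
  by rewrite mem_box; apply/forallP => l; rewrite idx0E.
have := sum_box_prod n.+1 (fun=> tree_weight).
rewrite prodr_const card_ord (bigD1_seq 0 b0 (box_uniq _)) /=.
rewrite [X in X + _]big1 => [|l _]; last by rewrite idx0E.
rewrite -mulr_sumr; have := sum_tree_weight_le n.+1.
have : 0 <= \sum_(i < n.+1) tree_weight i.
  by apply: sumr_ge0 => i _; exact: tree_weight_ge0.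
set S := \sum_(i < n.+1) _ => S0 S3 e.
(* Without the index 0 the total is at most (27 - 1) / 1000, which is below 1/24. *)
have : S ^+ 3 <= 3 ^+ 3 by apply: lerXn2r; rewrite ?nnegrE.
rewrite -e; set Q := \sum_(i <- _ | _) _.
have -> : 10^-1 ^+ 3 = 1000^-1 :> R by rewrite exprVn -natrX.
have -> : 3 ^+ 3 = 27 :> R by rewrite -natrX.
lra.
Qed.

Lemma majorant_exists : exists A : idx -> R,
  [/\ A 0 = 0, forall k, 0 <= A k <= 1
    & forall k, k != 0 ->
        A k = tree_coef k + 6 * \sum_(p <- pairs k | nzpair p) A p.1 * A p.2].
Proof.
have [f g' k fg|A AE] := @graded_fixpoint R 0 (fun A k => if k == 0 then 0 else
    tree_coef k + 6 * \sum_(p <- pairs k | nzpair p) A p.1 * A p.2).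
  case: ifP => // _; congr (_ + 6 * _); rewrite big_seq_cond [RHS]big_seq_cond.
  by apply: eq_bigr => p /andP[pk /(nzpair_absk pk)[p1 p2]]; rewrite !fg.
have A0 : A 0 = 0 by rewrite AE eqxx.
have AN k : k != 0 ->
    A k = tree_coef k + 6 * \sum_(p <- pairs k | nzpair p) A p.1 * A p.2.
  by move=> k0; rewrite {1}AE (negbTE k0).
have Age0 k : 0 <= A k.
  have [n kn] := ubnP (absk k); elim: n k kn => // n ihn k kn.
  have [->|k0] := eqVneq k 0; first by rewrite A0.
  rewrite AN// addr_ge0 ?tree_coef_ge0// mulr_ge0// big_seq_cond sumr_ge0// => p.
  move=> /andP[pk /(nzpair_absk pk)[p1 p2]].
  by rewrite mulr_ge0 ?ihn ?(leq_trans p1 kn) ?(leq_trans p2 kn).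
(* Both members of a nonzero pair of total degree at most [n] have degree below [n], so raising the
   cut by one gives at most [1/24 + 6 * (S * S)], and the bound 1/12 reproduces itself. *)
have main m n : \sum_(k <- box m | (absk k < n)%N) A k <= 12^-1.
  elim: n => [|n ihn]; first by rewrite big_pred0.
  set S := \sum_(k <- _ | _) _ in ihn.
  have S0 : 0 <= S by apply: sumr_ge0.
  have : \sum_(k <- box m | k != 0) tree_coef k + 6 * (S * S) <= 12^-1.
    by have := sum_tree_coef_le m; nra.
  apply: le_trans.
  rewrite (bigID (fun k => k == 0)) /= big1 ?add0r => [|k /andP[_ /eqP->]//].
  rewrite (eq_bigr (fun k => tree_coef k +
    6 * \sum_(p <- pairs k | nzpair p) A p.1 * A p.2)) => [|k /andP[_ /AN]//].
  rewrite big_split /=; apply: lerD.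
    rewrite big_mkcond [leRHS]big_mkcond; apply: ler_sum => k _.
    by case: (_ < _)%N; case: (k != 0) => //=; exact: tree_coef_ge0.
  rewrite -mulr_sumr ler_pM2l//.
  have -> : S * S = \sum_(p <- [seq (a, b) | a <- box m, b <- box m])
      (if (absk p.1 < n)%N then A p.1 else 0) *
      (if (absk p.2 < n)%N then A p.2 else 0).
    by rewrite (boxX_sum m (fun k => if (absk k < n)%N then A k else 0)
      (fun k => if (absk k < n)%N then A k else 0)) -!big_mkcond.
  apply: (@le_trans _ _ (\sum_(k <- box m) \sum_(p <- pairs k | nzpair p)
      (if (absk p.1 < n)%N then A p.1 else 0) *
      (if (absk p.2 < n)%N then A p.2 else 0))).
    rewrite big_mkcond; apply: ler_sum => k _; case: ifPn => [/andP[kn _]|_].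
      rewrite big_seq_cond [leRHS]big_seq_cond; apply: ler_sum => p.
      move=> /andP[pk /(nzpair_absk pk)[p1 p2]].
      by rewrite (leq_trans p1 kn) (leq_trans p2 kn).
    by apply: sumr_ge0 => p _; rewrite mulr_ge0//; case: ifP.
  rewrite sum_box_pairs big_mkcond; apply: ler_sum => p _.
  have : 0 <= (if (absk p.1 < n)%N then A p.1 else 0) *
    (if (absk p.2 < n)%N then A p.2 else 0) by rewrite mulr_ge0//; case: ifP.
  by case: (_ && _).
exists A; split=> // k; rewrite Age0/=.
have : A k <= \sum_(m <- box (absk k).+1 | (absk m < (absk k).+1)%N) A m.
  rewrite (big_rem k) ?mem_box_absk//= ltnSn lerDl sumr_ge0//.
by move=> /le_trans; apply; apply: le_trans (main _ _) _; lra.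
Qed.

End TreeWeights.

(** * The projected system of modes and its polynomial solution *)

Section Modes.
Context {R : realType}.

(** The ring is arbitrary because the modes are built in [{poly R}] and evaluated afterwards. *)
Definition dot (S : pzRingType) (k : idx) (v : 'I_3 -> S) : S :=
  \sum_l (k l)%:R * v l.

Definition norm2 (k : idx) : R := dot k (fun l => (k l)%:R).

Definition kdir (k : idx) (j : 'I_3) : R := (k j)%:R / norm2 k.

(* The Leray projection [w j - kdir k j * dot k w] eliminates the pressure. *)
Definition nonlin (S : pzRingType) (c : 'I_3 -> S) (k : idx)
    (v : idx -> 'I_3 -> S) (j : 'I_3) : S :=
  \sum_(p <- pairs k | nzpair p)
    dot k (v p.1) * (v p.2 j - c j * dot k (v p.2)).

Lemma norm2_gt0 k : k != 0 -> 0 < norm2 k.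
Proof.
rewrite -absk_gt0 abskE /norm2 /dot sum3 => k0.
have : 0 < ((k o0)%:R + (k o1)%:R + (k o2)%:R : R) by rewrite -!natrD ltr0n.
move: ((k o0)%:R : R) ((k o1)%:R : R) ((k o2)%:R : R) => x y z s0.
have := mulr_gt0 s0 s0; have := sqr_ge0 (x - y); have := sqr_ge0 (x - z).
have := sqr_ge0 (y - z); nra.
Qed.

Lemma kdir_dot k : k != 0 -> dot k (kdir k) = 1.
Proof.
move=> k0; rewrite /dot /kdir; under eq_bigr do rewrite mulrA.
by rewrite -mulr_suml divff// gt_eqF// norm2_gt0.
Qed.

Lemma dot_ler (k : idx) (w : 'I_3 -> R) m : (forall l, `|w l| <= m) ->
  `|dot k w| <= (absk k)%:R * m.
Proof.
move=> wm; apply: (le_trans (ler_norm_sum _ _ _)).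
rewrite natr_sum mulr_suml; apply: ler_sum => l _.
by rewrite normrM normr_nat; apply: ler_wpM2l.
Qed.

Lemma kdir_ge0 k j : 0 <= kdir k j.
Proof.
by rewrite divr_ge0// sumr_ge0// => l _; rewrite mulr_ge0.
Qed.

(** Amounts to x (x + y + z) <= 2 (x^2 + y^2 + z^2), from 2 x y <= x^2 + y^2. Added to the identity
    part of the projection, it makes the 3 of [leray_ler]. *)
Lemma kdir_le k j : k != 0 -> kdir k j * (absk k)%:R <= 2.
Proof.
move=> k0; have n0 := norm2_gt0 k0; rewrite /kdir mulrAC ler_pdivrMr//.
rewrite /norm2 /dot sum3 abskE !natrD.
have := ler0n R (k o0); have := ler0n R (k o1); have := ler0n R (k o2).
have : k j \in [:: k o0; k o1; k o2].
  case: j => -[|[|[|//]]] jl; rewrite !inE; apply/or3P;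
    [constructor 1|constructor 2|constructor 3]; apply/eqP; congr (k _);
    exact/val_inj.
move: (k j) (k o0) (k o1) (k o2) => a b c d; rewrite !inE => /or3P[]/eqP ->;
  move: (b%:R : R) (c%:R : R) (d%:R : R) => x y z z0 y0 x0.
- have := sqr_ge0 (x - y); have := sqr_ge0 (x - z); nra.
- have := sqr_ge0 (y - x); have := sqr_ge0 (y - z); nra.
- have := sqr_ge0 (z - x); have := sqr_ge0 (z - y); nra.
Qed.

Lemma leray_ler k j (w : 'I_3 -> R) m : k != 0 -> (forall l, `|w l| <= m) ->
  `|w j - kdir k j * dot k w| <= 3 * m.
Proof.
move=> k0 wm; apply: (le_trans (ler_normB _ _)).
have -> : 3 * m = m + 2 * m by ring.
have m0 : 0 <= m by apply: le_trans (wm ord0).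
apply: lerD => //; rewrite normrM (ger0_norm (kdir_ge0 _ _)).
apply: le_trans (ler_wpM2l (kdir_ge0 _ _) (dot_ler k wm)) _.
by rewrite mulrA; apply: ler_wpM2r => //; exact: kdir_le.
Qed.

Lemma dot_nonlin k (v : idx -> 'I_3 -> R) : k != 0 ->
  dot k (nonlin (kdir k) k v) = 0.
Proof.
move=> k0; rewrite /dot /nonlin; under eq_bigr do rewrite mulr_sumr.
rewrite exchange_big big1// => p _ /=; under eq_bigr do rewrite mulrCA mulrBr.
rewrite -mulr_sumr sumrB -/(dot k (v p.2)).
under [X in _ * (_ - X)]eq_bigr do rewrite mulrA.
by rewrite -mulr_suml -/(dot k (kdir k)) kdir_dot// mul1r subrr mulr0.
Qed.

(** Each term is bilinear in the modes [p.1] and [p.2], and [p.1 + p.2 = k]. The case of interest is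
    [e m = expR (dot m b * t)], the factor of the mean flow. *)
Lemma nonlin_scale k c (v : idx -> 'I_3 -> R) (e : idx -> R) j :
  (forall a b, e (a + b) = e a * e b) ->
  nonlin c k (fun m l => e m * v m l) j = e k * nonlin c k v j.
Proof.
move=> eD; rewrite /nonlin mulr_sumr big_seq_cond [RHS]big_seq_cond.
apply: eq_bigr => p /andP[]; rewrite mem_pairs => /eqP <- _; rewrite eD.
have dote m (x : R) w : dot m (fun l => x * w l) = x * dot m w.
  by rewrite /dot mulr_sumr; apply: eq_bigr => l _; rewrite mulrCA.
by rewrite !dote; ring.
Qed.

Definition antideriv (p : {poly R}) : {poly R} :=
  \poly_(i < (size p).+1) (p`_i.-1 / i%:R).

Lemma coef_antideriv p i : (antideriv p)`_i = p`_i.-1 / i%:R.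
Proof.
rewrite coef_poly; case: ltnP => // pi.
by rewrite nth_default ?mul0r//; case: i pi.
Qed.

Lemma deriv_antideriv p : (antideriv p)^`() = p.
Proof.
apply/polyP => i; rewrite coef_deriv coef_antideriv /= -[LHS]mulr_natr.
by rewrite divfK ?pnatr_eq0.
Qed.

Lemma antideriv0 p : (antideriv p).[0] = 0.
Proof. by rewrite horner_coef0 coef_antideriv invr0 mulr0. Qed.

Lemma horner_nonlin (c : 'I_3 -> R) k (V : idx -> 'I_3 -> {poly R}) j t :
  (nonlin (fun l => (c l)%:P) k V j).[t] = nonlin c k (fun m l => (V m l).[t]) j.
Proof.
have hdot (W : 'I_3 -> {poly R}) : (dot k W).[t] = dot k (fun l => (W l).[t]).
  by rewrite /dot horner_sum; apply: eq_bigr => l _;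
    rewrite -polyC_natr hornerM hornerC.
rewrite /nonlin horner_sum; apply: eq_bigr => p _.
by rewrite hornerM hornerD hornerN hornerM hornerC !hdot.
Qed.

Lemma nonlin_local (S : pzRingType) (c : 'I_3 -> S) k (v w : idx -> 'I_3 -> S) :
  (forall m, (absk m < absk k)%N -> v m = w m) -> nonlin c k v = nonlin c k w.
Proof.
move=> vw; apply/funext => j; rewrite /nonlin big_seq_cond [RHS]big_seq_cond.
by apply: eq_bigr => p /andP[pk /(nzpair_absk pk)[p1 p2]]; rewrite !vw.
Qed.

(** [nzpair] leaves only modes of degree below [absk k] on the right, so each mode is its initial
    value plus an antiderivative of a known polynomial, and the solution is global in time. *)
Lemma profile_exists (B : 'I_3 -> idx -> R) :
  exists v : idx -> 'I_3 -> R -> R,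
  [/\ forall j t, v 0 j t = 0,
      forall k j, k != 0 -> v k j 0 = B j k
    & forall k j (t : R),
        is_derive t 1 (v k j) (nonlin (kdir k) k (fun m l => v m l t) j)].
Proof.
have [f g k fg|V VE] := @graded_fixpoint ('I_3 -> {poly R}) (fun=> 0)
    (fun V k j => if k == 0 then 0 else
      (B j k)%:P + antideriv (nonlin (fun l => (kdir k l)%:P) k V j)).
  by apply/funext => j; rewrite (nonlin_local _ fg).
have V0 j : V 0 j = 0 by rewrite VE eqxx.
exists (fun k j t => (V k j).[t]); split=> [j t|k j k0|k j t].
- by rewrite V0 horner0.
- by rewrite VE (negbTE k0) hornerD hornerC antideriv0 addr0.
- apply: (is_derive_eq (is_derive_poly (V k j) t)); rewrite -horner_nonlin.
  have [->|k0] := eqVneq k 0.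
    rewrite V0 deriv0 /nonlin big_seq_cond big1 ?horner0// => p /andP[pk].
    by move=> /(nzpair_absk pk)[]; rewrite absk0.
  by rewrite {1}VE (negbTE k0) derivD derivC add0r deriv_antideriv.
Qed.

(** For [s = 1] and [s = - 1] the function [M * (1 + u) ^+ n - s * f u] is nondecreasing on the
    half-line. The factor [n%:R] in the bound on [df] makes [(1 + u) ^+ n] its exact primitive. *)
Lemma power_growth_bound (f df : R -> R) (M m t : R) n :
  (forall u : R, is_derive u 1 f (df u)) ->
  (forall u : R, 0 <= u -> `|df u| <= M * (n%:R * (1 + u) ^+ n.-1)) ->
  `|f 0| <= m -> 0 <= t -> `|f t| <= m + M * ((1 + t) ^+ n - 1).
Proof.
move=> fd fM f0 t0.
have side (s : R) : `|s| = 1 -> s * f t <= s * f 0 + M * ((1 + t) ^+ n - 1).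
  move=> s1.
  pose g (u : R) := M * (horner ((1 + 'X) ^+ n) u) + - s * f u.
  have gd (u : R) : is_derive u 1 g (M * (n%:R * (1 + u) ^+ n.-1) + - s * df u).
    have pd := is_derive_poly ((1 + 'X) ^+ n : {poly R}) u.
    have -> : n%:R * (1 + u) ^+ n.-1 = ((1 + 'X) ^+ n)^`().[u].
      by rewrite deriv_exp derivD derivC derivX add0r mul1r hornerMn horner_exp
        hornerD hornerC hornerX mulr_natl.
    by apply: is_deriveD; exact: is_derive_mull.
  have [|c] := @MVT_segment R g _ 0 t t0 (fun u _ => gd u).
    by apply: continuous_subspaceT; exact: is_derive_continuous gd.
  rewrite in_itv /= => /andP[c0 _]; rewrite /g subr0 !horner_exp !hornerD !hornerC
    !hornerX addr0 expr1n => h.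
  have : - s * df c + M * (n%:R * (1 + c) ^+ n.-1) >= 0.
    have : s * df c <= `|df c| by rewrite -[leRHS]mul1r -s1 -normrM ler_norm.
    by have := fM c c0; rewrite mulNr; lra.
  by move=> /mulr_ge0 /(_ t0); rewrite addrC -h; lra.
have s1 := side 1 (normr1 R); have sN1 := side (- 1) (etrans (normrN 1) (normr1 R)).
have f0p := ler_norm (f 0); have f0n := ler_norm (- f 0); rewrite normrN in f0n.
by rewrite ler_norml; apply/andP; split; lra.
Qed.

End Modes.

(** * Uniform bounds on the modes *)

Section ModeBounds.
Context {R : realType}.
Implicit Types (B : 'I_3 -> idx -> R).

Lemma profile_bound B (A : idx -> R) (rho : R) (v : idx -> 'I_3 -> R -> R) :
  0 <= rho -> (forall k, 0 <= A k <= 1) ->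
  (forall k, k != 0 ->
    A k = tree_coef k + 6 * \sum_(p <- pairs k | nzpair p) A p.1 * A p.2) ->
  (forall j (k : idx), k != 0 -> `|B j k| <= rho ^+ absk k * tree_coef k) ->
  (forall k j, k != 0 -> v k j 0 = B j k) ->
  (forall k j (t : R),
    is_derive t 1 (v k j) (nonlin (kdir k) k (fun m l => v m l t) j)) ->
  forall (k : idx) j t, k != 0 -> 0 <= t ->
    `|v k j t| <= rho ^+ absk k * A k * (1 + t) ^+ (absk k).-1.
Proof.
move=> rho0 A01 AE Bb v0 vd k.
(* Initial value plus growth, for [X = (1 + t) ^+ (absk k).-1]: both fit under [A k * X] because
   [X >= 1]. *)
have affine (r c Q X : R) : 0 <= r -> 0 <= c -> 0 <= Q -> 1 <= X ->
    r * c + r * (6 * Q) * (X - 1) <= r * (c + 6 * Q) * X.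
  move=> r0 c0 Q0 X1; rewrite -subr_ge0.
  have -> : r * (c + 6 * Q) * X - (r * c + r * (6 * Q) * (X - 1)) =
    r * c * (X - 1) + 6 * (r * Q) by ring.
  by rewrite addr_ge0 ?mulr_ge0 ?subr_ge0.
have A0 m : 0 <= A m by case/andP: (A01 m).
have [n kn] := ubnP (absk k); elim: n k kn => // n ihn k kn j t k0 t0.
set r := rho ^+ absk k; have r0 : 0 <= r by exact: exprn_ge0.
pose Q := \sum_(p <- pairs k | nzpair p) A p.1 * A p.2.
have Q0 : 0 <= Q by apply: sumr_ge0 => p _; exact: mulr_ge0.
have dv u : 0 <= u -> `|nonlin (kdir k) k (fun m l => v m l u) j| <=
    r * (6 * Q) * ((absk k).-1%:R * (1 + u) ^+ (absk k).-1.-1).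
  move=> u0; apply: (le_trans (ler_norm_sum _ _ _)).
  rewrite /Q mulr_sumr mulr_sumr mulr_suml big_seq_cond [leRHS]big_seq_cond.
  apply: ler_sum => p /andP[pk nzp]; have [p1k p2k] := nzpair_absk pk nzp.
  have ek := absk_pairs pk; have [/= p10 p20] := andP nzp.
  have h1 l := ihn p.1 (leq_trans p1k kn) l u p10 u0.
  have h2 l := ihn p.2 (leq_trans p2k kn) l u p20 u0.
  rewrite normrM.
  apply: le_trans (ler_pM _ _ (dot_ler _ h1) (leray_ler _ k0 h2)) _ => //.
  move: p10 p20; rewrite -!absk_gt0 /r -ek => p10 p20.
  (* The growth exponents of the two factors add up to [absk k - 2], the exponent that
     [power_growth_bound] expects of the derivative for [n = absk k - 1]. *)
  have -> : (absk p.1 + absk p.2).-1.-1 = ((absk p.1).-1 + (absk p.2).-1)%N.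
    by rewrite -{1}(prednK p10) -{1}(prednK p20) addSn addnS.
  rewrite !exprD.
  (* Both degrees are positive, so their sum is at least 2; this fixes the 6 in the recursion for
     [A]. *)
  have le6 : 3 * (absk p.1 + absk p.2)%:R <= 6 * (absk p.1 + absk p.2).-1%:R :> R.
    rewrite -!natrM ler_nat; move: p10 p20.
    by move: (absk p.1) (absk p.2) => a b; lia.
  set X := rho ^+ _; set Y := rho ^+ _; set Z := (1 + u) ^+ _.
  set W := (1 + u) ^+ _.
  have F0 : 0 <= X * Y * (A p.1 * A p.2) * (Z * W).
    by rewrite !mulr_ge0// ?exprn_ge0// addr_ge0.
  have := ler_wpM2r F0 le6.
  move: ((absk p.1 + absk p.2)%:R : R) ((absk p.1 + absk p.2).-1%:R : R) => N N1.
  move: (A p.1) (A p.2) => a1 a2 h.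
  have -> : N * (X * a1 * Z) * (3 * (Y * a2 * W)) =
    3 * N * (X * Y * (a1 * a2) * (Z * W)) by ring.
  have -> : X * Y * (6 * (a1 * a2)) * (N1 * (Z * W)) =
    6 * N1 * (X * Y * (a1 * a2) * (Z * W)) by ring.
  exact: h.
have v00 : `|v k j 0| <= r * tree_coef k by rewrite v0//; exact: Bb.
have := power_growth_bound (vd k j) dv v00 t0.
move=> /le_trans; apply; rewrite AE// -/Q.
have X1 : 1 <= (1 + t) ^+ (absk k).-1 by rewrite exprn_ege1// lerDl.
have c0 := @tree_coef_ge0 R k.
exact: affine.
Qed.

(** The projected right-hand side is orthogonal to [k], so [dot k] of the mode is constant in
    time. *)
Lemma dot_profile0 B (v : idx -> 'I_3 -> R -> R) :
  (forall k j, k != 0 -> v k j 0 = B j k) ->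
  (forall k j (t : R),
    is_derive t 1 (v k j) (nonlin (kdir k) k (fun m l => v m l t) j)) ->
  forall k t, k != 0 -> dot k (B ^~ k) = 0 -> dot k (fun l => v k l t) = 0.
Proof.
move=> v0 vd k t k0 Bk.
pose f (u : R) := dot k (fun l => v k l u).
have fd (u : R) : is_derive u 1 f 0.
  rewrite -(dot_nonlin (fun m l => v m l u) k0).
  rewrite /f /dot; under [fun _ => _]eq_fun do rewrite sum3; rewrite sum3.
  by apply: is_deriveD.
have := is_derive_0_is_cst t 0 fd; rewrite /f => ->.
by rewrite -[RHS]Bk /dot; apply: eq_bigr => l _; rewrite v0.
Qed.

(* The mean flow [b] acts on the [k]-th mode as the factor [exp ((k . b) t)]. *)
Lemma modes_exist B (b : 'I_3 -> R) (rho : R) :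
  0 <= rho -> (forall l, b l <= - 2) ->
  (forall j (k : idx), k != 0 -> `|B j k| <= rho ^+ absk k * tree_coef k) ->
  (forall k, k != 0 -> dot k (B ^~ k) = 0) ->
  exists S : idx -> 'I_3 -> R -> R,
  [/\ forall j t, S 0 j t = 0,
      forall k j, k != 0 -> S k j 0 = B j k,
      forall k j (t : R), is_derive t 1 (S k j)
        (dot k b * S k j t + nonlin (kdir k) k (fun m l => S m l t) j),
      forall k t, dot k (fun l => S k l t) = 0
    & forall k j t, 0 <= t -> `|S k j t| <= rho ^+ absk k].
Proof.
move=> rho0 b2 Bb Bdiv.
have [A [A0 A01 AE]] := @majorant_exists R.
have [v [vz v0 vd]] := profile_exists B.
pose S (k : idx) (j : 'I_3) (t : R) := expR (dot k b * t) * v k j t.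
have dotD (a c : idx) : dot (a + c) b = dot a b + dot c b :> R.
  by rewrite /dot -big_split; apply: eq_bigr => l _; rewrite idx_addE natrD mulrDl.
exists S; split=> [j t|k j k0|k j t|k t|k j t t0].
- by rewrite /S vz mulr0.
- by rewrite /S mulr0 expR0 mul1r v0.
- apply: (is_derive_eq (is_derive_mul (is_derive_expR_mul (dot k b) t) (vd k j t))).
  rewrite /S (@nonlin_scale _ k (kdir k) (fun m l => v m l t)
    (fun m => expR (dot m b * t))).
    by ring.
  by move=> a c; rewrite dotD mulrDl expRD.
- have [->|k0] := eqVneq k 0.
    by rewrite /dot big1// => l _; rewrite idx0E mul0r.
  rewrite /S (_ : dot _ _ = expR (dot k b * t) * dot k (fun l => v k l t)).
    by rewrite (dot_profile0 v0 vd)// ?mulr0//; exact: Bdiv.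
  by rewrite /dot mulr_sumr; apply: eq_bigr => l _; rewrite mulrCA.
- have [->|k0] := eqVneq k 0; first by rewrite /S vz mulr0 normr0 exprn_ge0.
  rewrite normrM ger0_norm ?expR_ge0//.
  have vb := profile_bound rho0 A01 AE Bb v0 vd j k0 t0.
  have kb : dot k b * t <= - ((absk k)%:R * t).
    rewrite -mulNr; apply: ler_wpM2r => //.
    rewrite /dot natr_sum -sumrN; apply: ler_sum => l _.
    by have := b2 l; have := ler0n R (k l); nra.
  have ek : expR (dot k b * t) * (1 + t) ^+ (absk k).-1 <= 1.
    have p1 : (1 + t) ^+ (absk k).-1 <= expR ((absk k)%:R * t).
      rewrite expRM_natl; apply: le_trans (_ : (1 + t) ^+ absk k <= _).
        by apply: ler_weXn2l; [rewrite lerDl|exact: leq_pred].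
      by apply: lerXn2r; rewrite ?nnegrE ?expR_ge0 ?addr_ge0// expR_ge1Dx.
    have := ler_pM (expR_ge0 _) (exprn_ge0 _ _)
      (_ : expR (dot k b * t) <= expR (- ((absk k)%:R * t))) p1.
    rewrite -expRD addNr expR0; apply; rewrite ?addr_ge0 ?ler_expR//.
  have /andP[Ak0 Ak1] := A01 k.
  apply: le_trans (ler_wpM2l (expR_ge0 _) vb) _.
  have rk0 : 0 <= rho ^+ absk k by exact: exprn_ge0.
  rewrite -mulrA mulrCA -[leRHS]mulr1; apply: ler_wpM2l => //.
  rewrite mulrCA -[leRHS]mulr1; apply: ler_pM => //.
  by rewrite mulr_ge0 ?expR_ge0// exprn_ge0// addr_ge0.
Qed.

End ModeBounds.

(** * Series dominated uniformly in time *)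

Section UniformSeries.
Context {R : realType}.
Implicit Types (a b : idx -> R -> R) (t : R) (x : 'rV[R]_3).

(** The constants are hidden because multiplication by a coordinate of [k] and convolution both
    replace [q] by [Num.sqrt q]; only the uniformity in [t >= 0] matters. *)
Definition geo a := exists C q, [/\ 0 <= C, 0 <= q, q < 1
  & forall t, 0 <= t -> dominated C q (a ^~ t)].

Lemma geo_le a b : (forall k t, 0 <= t -> `|b k t| <= `|a k t|) -> geo a -> geo b.
Proof.
move=> ba [C [q [C0 q0 q1 aq]]]; exists C, q; split=> // t t0.
by apply: dominated_le (aq t t0) => k; exact: ba.
Qed.

Lemma geo_eq a b : (forall k t, 0 <= t -> b k t = a k t) -> geo a -> geo b.
Proof. by move=> ba; apply: geo_le => k t t0; rewrite ba. Qed.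

Lemma dominated_weaken C C' q q' (a : idx -> R) : 0 <= C -> C <= C' -> 0 <= q ->
  q <= q' -> dominated C q a -> dominated C' q' a.
Proof.
move=> C0 CC' q0 qq' aq k; apply: le_trans (aq k) _.
apply: ler_pM => //; first exact: exprn_ge0.
by apply: lerXn2r => //; rewrite nnegrE// (le_trans q0).
Qed.

Lemma geo2 a b : geo a -> geo b -> exists C q, [/\ 0 <= C, 0 <= q, q < 1,
  forall t, 0 <= t -> dominated C q (a ^~ t)
  & forall t, 0 <= t -> dominated C q (b ^~ t)].
Proof.
move=> [C [q [C0 q0 q1 aq]]] [C' [q' [C'0 q'0 q'1 bq]]].
exists (C + C'), (Num.max q q'); split=> [|||t t0|t t0].
- exact: addr_ge0.
- by rewrite le_max q0.
- by rewrite gt_max q1.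
- by apply: dominated_weaken (aq t t0); rewrite ?lerDl// le_max lexx.
- by apply: dominated_weaken (bq t t0); rewrite ?lerDr// le_max lexx orbT.
Qed.

Lemma geoD a b : geo a -> geo b -> geo (fun k t => a k t + b k t).
Proof.
move=> ga gb; have [C [q [C0 q0 q1 aq bq]]] := geo2 ga gb.
exists (C + C), q; split=> // [|t t0 k]; first exact: addr_ge0.
rewrite mulrDl; apply: le_trans (ler_normD _ _) _.
by apply: lerD; [exact: aq|exact: bq].
Qed.

Lemma geo_sum (r : seq 'I_3) (a : 'I_3 -> idx -> R -> R) :
  (forall i, geo (a i)) -> geo (fun k t => \sum_(i <- r) a i k t).
Proof.
move=> ga; elim: r => [|i r ih].
  exists 0, 0; split=> // t _ k; rewrite big_nil normr0 mul0r //.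
by apply: geo_eq (geoD (ga i) ih) => k t _; rewrite big_cons.
Qed.

Lemma geo_absk a : geo a -> geo (fun k t => (absk k)%:R * a k t).
Proof.
move=> [C [q [C0 q0 q1 aq]]].
exists (C * (1 - Num.sqrt q)^-1), (Num.sqrt q); split=> [||| t t0].
- by rewrite mulr_ge0// invr_ge0 subr_ge0 ltW// sqrt_lt1.
- exact: sqrtr_ge0.
- exact: sqrt_lt1.
- by apply: dominated_mul_absk => //; exact: aq.
Qed.

Lemma geo_coord i a : geo a -> geo (fun k t => - (k i)%:R * a k t).
Proof.
move=> /geo_absk; apply: geo_le => k t _; rewrite !normrM normrN !normr_nat.
by apply: ler_wpM2r => //; rewrite ler_nat leq_absk.
Qed.

Lemma geo_convol a b :
  geo a -> geo b -> geo (fun k t => convol (a ^~ t) (b ^~ t) k).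
Proof.
move=> ga gb; have [C [q [C0 q0 q1 aq bq]]] := geo2 ga gb.
have s0 := sqrtr_ge0 q; have s1 := sqrt_lt1 q1.
exists (C * C * (1 - Num.sqrt q)^-1 ^+ 3), (Num.sqrt q); split=> // [|t t0].
  apply: mulr_ge0; first exact: mulr_ge0.
  by rewrite exprn_ge0// invr_ge0 subr_ge0 ltW.
by apply: convol_dominated => //; [exact: aq|exact: bq].
Qed.

Definition ser a x t : R := summability.sum (fun k => a k t * phi k x).

Lemma ser_has_sum a x t : geo a -> orthant x -> 0 <= t ->
  has_sum (fun k => a k t * phi k x) (ser a x t).
Proof.
move=> [C [q [C0 q0 q1 aq]]] xo t0; apply: (dominated_has_sum C0 q0 q1).
by apply: dominated_mul_phi => //; exact: aq.
Qed.

Lemma ser_expansion F a (a' : idx -> R -> R) :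
  geo a -> (forall k, continuous (a' k)) ->
  (forall k t, 0 <= t -> a k t = a' k t) ->
  (forall x t, orthant x -> 0 <= t -> F x t = ser a x t) ->
  series_expansion F a.
Proof.
move=> ga a'c aa' Fs; have [C [q [C0 q0 q1 aq]]] := ga.
apply: (series_expansionI C0 q0 q1 a'c aa' aq) => x t xo t0.
by rewrite Fs//; exact: ser_has_sum.
Qed.

Lemma ser_partial i a x t : geo a -> orthant x -> 0 <= t ->
  partial_derivable i (ser a ^~ t) x /\
  partial i (ser a ^~ t) x = ser (fun k t => - (k i)%:R * a k t) x t.
Proof.
move=> ga xo t0; have [C [q [C0 q0 q1 aq]]] := ga.
apply: (partial_has_sum C0 q0 q1 (aq t t0)) => // [y yo|].
  exact: ser_has_sum.
exact: (ser_has_sum (geo_coord i ga) xo t0).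
Qed.

Lemma ser_time a (da : idx -> R -> R) x t :
  geo a -> geo da -> (forall k (t : R), is_derive t 1 (a k) (da k t)) ->
  orthant x -> 0 <= t ->
  time_derivable (ser a x) t /\ time_derive (ser a x) t = ser da x t.
Proof.
move=> ga gda ad xo t0; have [C [q [C0 q0 q1 aq]]] := gda.
apply: (time_has_sum C0 q0 q1 xo ad aq) => // [u u0|]; exact: ser_has_sum.
Qed.

Lemma ser_mul a b x t : geo a -> geo b -> orthant x -> 0 <= t ->
  ser a x t * ser b x t = ser (fun k t => convol (a ^~ t) (b ^~ t) k) x t.
Proof.
move=> ga gb xo t0; have [C [q [C0 q0 q1 aq bq]]] := geo2 ga gb.
have := has_sum_convol C0 C0 q0 q1 (dominated_mul_phi xo (aq t t0))
  (dominated_mul_phi xo (bq t t0)) (ser_has_sum ga xo t0) (ser_has_sum gb xo t0).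
rewrite convol_mul_phi => /has_sum_unique; apply.
exact: (ser_has_sum (geo_convol ga gb) xo t0).
Qed.

Lemma continuous_sum (I : Type) (r : seq I) (P : pred I) (f : I -> R -> R) :
  (forall i, continuous (f i)) -> continuous (fun t => \sum_(i <- r | P i) f i t).
Proof.
move=> fc t; apply: (@cvg_big _ _ _ _ _ _ R (nbhs t)) => [|i _].
  exact: add_continuous.
exact: fc.
Qed.

Lemma continuous_mul (f g : R -> R) :
  continuous f -> continuous g -> continuous (fun t => f t * g t).
Proof. by move=> fc gc t; apply: cvgM; [exact: fc|exact: gc]. Qed.

End UniformSeries.

(** * The Euler equations mode by mode *)

Section FourierEuler.
Context {R : realType}.

Lemma absk_sqr_le (k : idx) : (absk k)%:R ^+ 2 <= 3 * norm2 k :> R.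
Proof.
rewrite /norm2 /dot sum3 abskE !natrD.
move: ((k o0)%:R : R) ((k o1)%:R : R) ((k o2)%:R : R) => x y z.
have := sqr_ge0 (x - y); have := sqr_ge0 (x - z); have := sqr_ge0 (y - z); nra.
Qed.

(** Pairing the momentum equation with [k] kills the time derivative and leaves a Poisson equation
    with symbol [norm2 k], in which the mean flow cancels by incompressibility. At [k = 0] the value
    is 0: the pressure gets no constant mode. *)
Definition pressure_mode (s : idx -> 'I_3 -> R) (k : idx) : R :=
  - (\sum_(p <- pairs k) dot k (s p.1) * dot k (s p.2)) / norm2 k.

(** As [s 0] vanishes, the sum may run over all pairs; the part that the projection removes is the
    pressure gradient. *)
Lemma nonlin_pairs (s : idx -> 'I_3 -> R) k j : (forall l, s 0 l = 0) ->
  nonlin (kdir k) k s j = \sum_(p <- pairs k) dot k (s p.1) * s p.2 j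
    + (k j)%:R * pressure_mode s k.
Proof.
move=> s0; have ds0 : dot k (s 0) = 0.
  by rewrite /dot big1// => l _; rewrite s0 mulr0.
rewrite /nonlin big_mkcond /=.
transitivity (\sum_(p <- pairs k) (dot k (s p.1) * s p.2 j -
    kdir k j * (dot k (s p.1) * dot k (s p.2)))).
  apply: eq_bigr => -[m n] _ /=; rewrite /nzpair /=.
  have [->|_] /= := eqVneq m 0; first by rewrite ds0 !mul0r mulr0 subrr.
  have [->|_] /= := eqVneq n 0; first by rewrite ds0 s0 !mulr0 subrr.
  by ring.
rewrite sumrB -mulr_sumr /pressure_mode /kdir; congr (_ + _).
by rewrite mulrAC mulrA mulrN mulNr.
Qed.

Lemma momentum_modes (s : idx -> 'I_3 -> R) (b : 'I_3 -> R) k j :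
  (forall l, s 0 l = 0) -> (forall m, dot m (s m) = 0) ->
  let T l m := (if m == 0 then b l else 0) + s m l in
  dot k b * s k j + nonlin (kdir k) k s j
  + \sum_i \sum_(p <- pairs k) - (p.2 i)%:R * T i p.1 * T j p.2
  + - (k j)%:R * pressure_mode s k = 0.
Proof.
move=> s0 sd T; rewrite nonlin_pairs// exchange_big /=.
suff -> : \sum_(p <- pairs k) \sum_i - (p.2 i)%:R * T i p.1 * T j p.2 =
    - (\sum_(p <- pairs k) dot k (s p.1) * s p.2 j) - dot k b * s k j by ring.
(* The drift term comes from the single pair [(0, k)]; once it is spread as a sum over pairs, the
   identity can be checked pair by pair. *)
have -> : dot k b * s k j =
    \sum_(p <- pairs k) (if p == (0, k) then dot k b * s k j else 0).
  rewrite -big_mkcond -big_filter filter_pred1_uniq ?pairs_uniq ?big_seq1//.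
  by rewrite mem_pairs /= add0r.
rewrite -!sumrN -big_split big_seq [RHS]big_seq; apply: eq_bigr => -[m n].
rewrite mem_pairs /= => /eqP mnk; rewrite -mulr_suml.
have -> : \sum_i - (n i)%:R * T i m = - dot n (T ^~ m).
  by rewrite /dot -sumrN; apply: eq_bigr => i _; rewrite mulNr.
(* Advection produces [dot n], the projected equation has [dot k]; the difference [dot m (s m)]
   vanishes by incompressibility. *)
have dsm : dot k (s m) = dot n (s m).
  rewrite -mnk /dot; under eq_bigr do rewrite idx_addE natrD mulrDl.
  by rewrite big_split /= -/(dot m (s m)) sd add0r.
rewrite dsm; have [n0|n0] := eqVneq n 0.
  have d0 w : dot n w = 0 :> R.
    by rewrite /dot big1// => l _; rewrite n0 idx0E mul0r.
  rewrite !d0 n0 s0 oppr0 !mul0r oppr0 add0r.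
  case: eqP => [[_ k0]|]; last by rewrite oppr0.
  by rewrite -k0 s0 mulr0 oppr0.
have -> : T j n = s n j by rewrite /T (negbTE n0) add0r.
have [m0|m0] := eqVneq m 0.
  have nk : n = k by rewrite -mnk m0 add0r.
  have -> : dot n (s m) = 0 by rewrite /dot big1// => l _; rewrite m0 s0 mulr0.
  rewrite nk m0 eqxx mul0r oppr0 add0r mulNr; congr (- (_ * _)).
  by apply: eq_bigr => l _; rewrite /T eqxx s0 addr0.
have -> : (m, n) == (0, k) = false by rewrite xpair_eqE (negbTE m0).
rewrite oppr0 addr0 mulNr; congr (- (_ * _)).
by apply: eq_bigr => l _; rewrite /T (negbTE m0) add0r.
Qed.

Lemma tree_coef_le1 k : k != 0 -> tree_coef k <= 1 :> R.
Proof.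
move=> k0; apply: (@le_trans _ _ 24^-1); last by lra.
apply: le_trans _ (@sum_tree_coef_le R (absk k).+1).
rewrite (big_rem k) ?mem_box_absk//= k0 lerDl sumr_ge0// => m _.
exact: tree_coef_ge0.
Qed.

(** The exponential splits into [expR (- e) ^+ absk k] and exp(- |k|); the latter is distributed
    over the coordinates as the exponential factors of the weights. *)
Lemma initial_bound (e z : R) (k : idx) :
  z <= expR (- ((absk k)%:R * (1 + e))) / 10 ^+ 3
       * \prod_(l < 3 | (0 < k l)%N) ((k l ^ (k l).-1)%N%:R / ((k l)`!)%:R) ->
  z <= expR (- e) ^+ absk k * tree_coef k.
Proof.
move=> /le_trans; apply.
rewrite /tree_coef big_mkcond.
have -> : \prod_l tree_weight (k l) = expR (- (absk k)%:R) * \prod_(l < 3)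
   (if (0 < k l)%N then (k l ^ (k l).-1)%N%:R / ((k l)`!)%:R else 1) :> R.
  rewrite natr_sum -sumrN expR_sum -big_split; apply: eq_bigr => l _ /=.
  by case: (k l) => [|n]; rewrite /= ?oppr0 ?expR0 ?mulr1.
rewrite mulrDr mulr1 opprD expRD -expRM_natl mulrN exprVn.
set P := \prod_(l < 3) _; set E := expR (- ((absk k)%:R * e)).
by rewrite le_eqVlt; apply/orP; left; apply/eqP; ring.
Qed.

End FourierEuler.

Theorem theorem3p9 (R : realType) (B : 'I_3 -> idx -> R)
    (u0 : 'I_3 -> 'rV[R]_3 -> R) (eps : R)
    (u0_sum : forall j x, orthant x ->
       has_sum (fun k => B j k * phi k x) (u0 j x))
    (u0_smooth : forall j, smooth (u0 j))
    (u0_div : divergence_free u0)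
    (B0_le : forall j, B j 0 <= - 2)
    (eps_gt0 : 0 < eps)
    (B_le : forall j (k : idx), k != 0 ->
       `|B j k| <= expR (- ((absk k)%:R * (1 + eps))) / 10 ^+ 3
                   * \prod_(l < 3 | (0 < k l)%N)
                       ((k l ^ (k l).-1)%N%:R / ((k l)`!)%:R)) :
  exists (u : 'I_3 -> 'rV[R]_3 -> R -> R) (p : 'rV[R]_3 -> R -> R)
         (T : 'I_3 -> idx -> R -> R) (T4 : idx -> R -> R),
    [/\ euler_solution u0 u p,
        forall j k (t : R), 0 <= t -> time_derivable (T j k) t
      & forall i j,
        [/\ series_expansion (u j) (T j) /\ series_expansion p T4,
            series_expansion (fun x => time_derive (u j x))
              (fun k => time_derive (T j k)),
            series_expansion (fun x t => partial i (u j ^~ t) x)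
              (fun k t => - (k i)%:R * T j k t),
            series_expansion (fun x t => partial j (p ^~ t) x)
              (fun k t => - (k j)%:R * T4 k t)
          & series_expansion
              (fun x t => u i x t * partial i (u j ^~ t) x)
              (eta_series T i j)]].
Proof.
set rho := expR (- eps); have rho0 : 0 <= rho by exact: expR_ge0.
have rho1 : rho < 1 by rewrite -expR0 ltr_expR oppr_lt0.
have Bb j (k : idx) : k != 0 -> `|B j k| <= rho ^+ absk k * tree_coef k.
  by move=> k0; apply: initial_bound; exact: B_le.
pose b j := B j 0.
(* The size of [B j 0] is not limited by the hypotheses, so it goes into the constant;
   [tree_coef k <= 1] covers the other coefficients. *)
have geoB j : geo (fun k _ => B j k).
  exists (`|b j| + 1), rho; split=> // t _ k.
  have [->|k0] := eqVneq k 0.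
    by rewrite absk0 expr0 mulr1 lerDl.
  apply: le_trans (Bb j k k0) _; rewrite mulrC.
  apply: ler_wpM2r; first exact: exprn_ge0.
  by rewrite (le_trans (tree_coef_le1 k0))// lerDr.
(* The divergence of [u0] is the exponential series with coefficients [- dot k (B ^~ k)]; it
   vanishes on the orthant, hence coefficient by coefficient. *)
have B_div k : dot k (B ^~ k) = 0.
  have gc : geo (fun k (_ : R) => \sum_(i < 3) - (k i)%:R * B i k).
    by apply: geo_sum => i; exact: geo_coord (geoB i).
  have [C [q [C0 q0 q1 /(_ 0 (lexx 0)) cq]]] := gc.
  apply/eqP; rewrite -oppr_eq0; apply/eqP.
  have := has_sum_phi_eq0 C0 q0 q1 cq; move=> /(_ _ k) <-.
    by rewrite /dot -sumrN; apply: eq_bigr => i _; rewrite mulNr.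
  move=> x xo.
  have hp i : has_sum (fun k => - (k i)%:R * B i k * phi k x) (partial i (u0 i) x).
    have hs := ser_has_sum (geo_coord i (geoB i)) xo (lexx 0).
    have [C' [q' [C'0 q'0 q'1 /(_ 0 (lexx 0)) Bq]]] := geoB i.
    by have [_ ->] := partial_has_sum C'0 q'0 q'1 Bq (u0_sum i) xo hs.
  have := has_sum_sum (r := index_enum 'I_3) hp; rewrite u0_div//.
  by under eq_fun do rewrite -mulr_suml.
have b2 l : b l <= - 2 by exact: B0_le.
have [S [S0 SB Sd Sdiv Sb]] := modes_exist rho0 b2 Bb (fun k _ => B_div k).
pose sm t : idx -> 'I_3 -> R := fun k l => S k l t.
(* The constant mode of the velocity keeps its initial value [b] for all times. *)
pose T j k t := (if k == 0 then b j else 0) + S k j t.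
pose T4 k t := pressure_mode (sm t) k.
pose dT j k t := dot k b * S k j t + nonlin (kdir k) k (sm t) j.
have Td j k (t : R) : is_derive t 1 (T j k) (dT j k t).
  by rewrite -[dT j k t]add0r; apply: is_deriveD.
have geoT j : geo (T j).
  have gS : geo (fun k t => S k j t).
    by exists 1, rho; split=> // t t0 k; rewrite mul1r; exact: Sb.
  (* With [q = 0] the bound [0 ^+ absk k] is the indicator of [k = 0]. *)
  apply: geoD gS; exists `|b j|, 0; split=> // t _ k.
  rewrite -absk_eq0; case: (absk k) => [|n] /=; first by rewrite expr0 mulr1.
  by rewrite normr0 mulr_ge0.
have geoT4 : geo T4.
  have gr : geo (fun k (_ : R) => rho ^+ absk k).
    by exists 1, rho; split=> // t _ k; rewrite ger0_norm ?exprn_ge0// mul1r.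
  have [C [q [C0 q0 q1 cq]]] := geo_convol gr gr.
  exists (3 * C), q; split=> // [|t t0 k]; first by rewrite mulr_ge0.
  have [->|k0] := eqVneq k 0.
    rewrite /T4 /pressure_mode big1 => [|p _]; last first.
      by rewrite /dot big1 ?mul0r// => l _; rewrite idx0E mul0r.
    by rewrite oppr0 mul0r normr0 !mulr_ge0// exprn_ge0.
  have n0 : 0 < norm2 k :> R := norm2_gt0 k0.
  rewrite /T4 /pressure_mode normrM normrN normfV (ger0_norm (ltW n0)).
  rewrite ler_pdivrMr//.
  have cqk := cq t t0 k; set Q := convol _ _ k in cqk.
  have Q0 : 0 <= Q by apply: sumr_ge0 => p _; rewrite mulr_ge0// exprn_ge0.
  rewrite ger0_norm// in cqk.
  (* The two factors [dot k] cost the square of [absk k], at most [3 * norm2 k], which the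
     denominator of the pressure cancels; a convolution of geometric sequences remains. *)
  apply: (@le_trans _ _ ((absk k)%:R ^+ 2 * Q)).
    apply: (le_trans (ler_norm_sum _ _ _)); rewrite mulr_sumr.
    apply: ler_sum => p _.
    rewrite normrM; apply: le_trans (ler_pM _ _
      (dot_ler _ (fun l => Sb p.1 l t t0))
      (dot_ler _ (fun l => Sb p.2 l t t0))) _ => //.
    by rewrite mulrACA expr2.
  apply: (@le_trans _ _ (3 * norm2 k * Q)).
    by apply: ler_wpM2r => //; exact: absk_sqr_le.
  rewrite mulrAC; apply: ler_wpM2r; first exact: ltW.
  by rewrite -mulrA; apply: ler_wpM2l.
have etaE i j k t : eta_series T i j k t =
    convol (fun k => T i k t) (fun k => - (k i)%:R * T j k t) k.
  rewrite /eta_series fsbig_pairs /convol; apply: eq_bigr => p _.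
  by rewrite -mulrA mulrCA.
have geo_eta i j : geo (eta_series T i j).
  apply: geo_eq (geo_convol (geoT i) (geo_coord i (geoT j))) => k t _.
  exact: etaE.
have momentum j k t :
    dT j k t + \sum_i eta_series T i j k t + - (k j)%:R * T4 k t = 0.
  under eq_bigr do rewrite /eta_series fsbig_pairs.
  exact: (momentum_modes b k j (S0^~ t) (fun m => Sdiv m t)).
(* The momentum identity is solved for [dT], which is then minus a sum of families already known to
   decay. *)
have geo_dT j : geo (dT j).
  have gs : geo (fun k t =>
      \sum_(i < 3) eta_series T i j k t + - (k j)%:R * T4 k t).
    by apply: geoD (geo_coord j geoT4); apply: geo_sum => i; exact: geo_eta.
  apply: geo_le gs => k t _; rewrite -[leRHS]normrN.
  by have /eqP := momentum j k t; rewrite -addrA addr_eq0 => /eqP ->.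
have Sc k j : continuous (S k j) by exact: is_derive_continuous (Sd k j).
have Tc j k : continuous (T j k) by exact: is_derive_continuous (Td j k).
have cstc (c : R) : continuous (fun _ : R => c) by move=> t; exact: cvg_cst.
have dotc k m : continuous (fun t => dot k (sm t m)).
  by apply: continuous_sum => l; apply: continuous_mul => //; exact: Sc.
have T4c k : continuous (T4 k).
  apply: (@continuous_mul R) => // t; apply: cvgN; move: t.
  by apply: continuous_sum => p; apply: continuous_mul; exact: dotc.
have dTc j k : continuous (dT j k).
  move=> t; apply: cvgD; move: t.
    by apply: continuous_mul => //; exact: Sc.
  apply: continuous_sum => p; apply: continuous_mul; first exact: dotc.
  move=> t; apply: cvgB; first exact: Sc.
  by move: t; apply: continuous_mul => //; exact: dotc.
have etac i j k : continuous (eta_series T i j k).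
  rewrite (_ : eta_series T i j k = fun t => convol (fun k => T i k t)
    (fun k => - (k i)%:R * T j k t) k); last by apply/funext => t; exact: etaE.
  apply: continuous_sum => p; apply: continuous_mul; first exact: Tc.
  by apply: continuous_mul => //; exact: Tc.
have up i j x t : orthant x -> 0 <= t ->
    partial_derivable i (ser (T j) ^~ t) x /\ partial i (ser (T j) ^~ t) x =
    ser (fun k t => - (k i)%:R * T j k t) x t.
  by move=> xo t0; exact: ser_partial.
have pp j x t : orthant x -> 0 <= t ->
    partial_derivable j (ser T4 ^~ t) x /\ partial j (ser T4 ^~ t) x =
    ser (fun k t => - (k j)%:R * T4 k t) x t.
  by move=> xo t0; exact: ser_partial.
have ut j x t : orthant x -> 0 <= t -> time_derivable (ser (T j) x) t /\
    time_derive (ser (T j) x) t = ser (dT j) x t.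
  by move=> xo t0; exact: ser_time.
have uu i j x t : orthant x -> 0 <= t ->
    ser (T i) x t * partial i (ser (T j) ^~ t) x = ser (eta_series T i j) x t.
  move=> xo t0; have [_ ->] := up i j x t xo t0.
  rewrite (ser_mul (geoT i) (geo_coord i (geoT j)))//.
  by congr (summability.sum _); apply/funext => k; rewrite etaE.
exists (fun j => ser (T j)), (ser T4), T, T4; split.
- split=> [x t xo t0|j x t xo t0|t t0 x xo|j x xo].
  + split=> [j|i j|j]; [exact: (ut _ _ _ xo t0).1|exact: (up _ _ _ _ xo t0).1|].
    exact: (pp _ _ _ xo t0).1.
  + under eq_bigr do rewrite uu//.
    have [_ ->] := ut j x t xo t0; have [_ ->] := pp j x t xo t0.
    have h := has_sumD (has_sumD (ser_has_sum (geo_dT j) xo t0)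
      (has_sum_sum (r := index_enum 'I_3)
        (fun i => ser_has_sum (geo_eta i j) xo t0)))
      (ser_has_sum (geo_coord j geoT4) xo t0).
    apply: (has_sum_unique h).
    under eq_fun do rewrite -mulr_suml -!mulrDl momentum mul0r.
    exact: has_sum0.
  + have h := has_sum_sum (r := index_enum 'I_3)
      (fun i => ser_has_sum (geo_coord i (geoT i)) xo t0).
    under eq_bigr do rewrite (up _ _ _ _ xo t0).2.
    apply: (has_sum_unique h).
    have -> : (fun k : idx => \sum_(i < 3) - (k i)%:R * T i k t * phi k x) =
        fun=> 0.
      apply/funext => k; rewrite -mulr_suml.
      have -> : \sum_(i < 3) - (k i)%:R * T i k t = - dot k (fun l => S k l t).
        rewrite /dot -sumrN; apply: eq_bigr => i _; rewrite mulNr /T.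
        (* The mean flow enters only at [k = 0], where the factor [k i] is zero. *)
        by have [->|_] := eqVneq k 0; rewrite ?add0r// idx0E !mul0r.
      by rewrite Sdiv oppr0 mul0r.
    exact: has_sum0.
  + have h := ser_has_sum (geoT j) xo (lexx 0).
    apply: (has_sum_unique h); have := u0_sum j x xo.
    have -> // : (fun k => B j k * phi k x) = fun k => T j k 0 * phi k x.
    apply/funext => k; congr (_ * _); rewrite /T.
    by have [->|k0] := eqVneq k 0; rewrite ?S0 ?addr0// SB// add0r.
- by move=> j k t t0; exact: (time_derive_eq t0 (Td j k t)).1.
- move=> i j; split.
  + split; first exact: (ser_expansion (geoT j) (Tc j)).
    exact: (ser_expansion geoT4 T4c).
  (* The one-sided derivative is known only for [t >= 0]; [dT] is its representative continuous on
     the whole line. *)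
  + have e k t : 0 <= t -> time_derive (T j k) t = dT j k t.
      by move=> t0; exact: (time_derive_eq t0 (Td j k t)).2.
    apply: (ser_expansion _ (dTc j)) => //.
      exact: geo_eq (geo_dT j).
    move=> x t xo t0; rewrite (ut j x t xo t0).2; congr (summability.sum _).
    by apply/funext => k; rewrite e.
  + apply: (ser_expansion (geo_coord i (geoT j))
      (a' := fun k t => - (k i)%:R * T j k t)) => // [k|x t xo t0].
      by apply: continuous_mul => //; exact: Tc.
    exact: (up _ _ _ _ xo t0).2.
  + apply: (ser_expansion (geo_coord j geoT4)
      (a' := fun k t => - (k j)%:R * T4 k t)) => // [k|x t xo t0].
      by apply: continuous_mul => //; exact: T4c.
    exact: (pp _ _ _ xo t0).2.
  + apply: (ser_expansion (geo_eta i j) (etac i j)) => // x t xo t0.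
    exact: uu.
Qed.
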